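(* Let $\beta\in(0,1)$, and let $A(t)$ and $u(x,t)$ be as in the context. For $t\ll 1$, $A(t)$ decreases (i.e. $A$ is decreasing on $(0,\delta)$ for some $\delta>0$). More precisely, as $t\to 0^+$, $$A(t)=1-\frac{t^{2\beta}}{8}\left(\frac{2}{\Gamma(1+2\beta)}-\frac{1}{\Gamma(1+\beta)^2}\right)+O(t^{4\beta}).$$ Furthermore, there exist $C,t_0>0$ such that for every $t\ge t_0$ and every $x\in\mathbb{R}$, $$\left|u(x,t)-\frac23\right|\le\frac{C\,t^{-\beta}}{\Gamma(1-\beta)}.$$
   Context: The Mittag-Leffler function is $E_{a,b}(z)=\sum_{n=0}^\infty\frac{z^n}{\Gamma(an+b)}$ ($a,b>0$), with $E_a:=E_{a,1}$. For $x\in\mathbb{R}$, $t\ge0$ define $$u(x,t)=\frac23\left\{1+\cos\left(\frac x2\right)E_{2\beta}\left(-\frac{t^{2\beta}}{4}\right)+\sin\left(\frac x2\right)\frac{t^\beta}{2}E_{2\beta,1+\beta}\left(-\frac{t^{2\beta}}{4}\right)\right\},$$ which is the series solution, produced by the homotopy perturbation method, of the fractional $K(2,2)$ equation $\partial_t^\beta u+\partial_x(u^2)+\partial_x^3(u^2)=0$ (Caputo derivative in time) with initial datum $\frac43\cos^2(x/4)$. Its amplitude is $$A(t)=\left(E_{2\beta}\left(-\frac{t^{2\beta}}{4}\right)^2+\frac{t^{2\beta}}{4}E_{2\beta,1+\beta}\left(-\frac{t^{2\beta}}{4}\right)^2\right)^{1/2}.$$ *)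

(* Defs.v *)
From HB Require Import structures.
From mathcomp Require Import all_boot all_order all_algebra.
From mathcomp Require Import all_classical all_reals all_analysis.

Set Implicit Arguments.
Unset Strict Implicit.
Unset Printing Implicit Defensive.

Import Order.TTheory GRing.Theory Num.Theory.
Import numFieldNormedType.Exports.

Local Open Scope classical_set_scope.
Local Open Scope ring_scope.

(* Euler's integral, hence the Gamma function only for 0 < x; no other argument
   occurs below. *)
Definition Gamma (R : realType) (x : R) : R :=
  \int[lebesgue_measure]_(s in `]0, +oo[%classic) (s `^ (x - 1) * expR (- s)).

(* E_{a,b}(z) for a, b > 0, at real arguments z; the series converges for
   every z. *)
Definition mittag_leffler (R : realType) (a b z : R) : R :=
  limn (series (fun n : nat => z ^+ n / Gamma (a * n%:R + b))).

Definition amplitude (R : realType) (beta t : R) : R :=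
  Num.sqrt (mittag_leffler (2 * beta) 1 (- (t `^ (2 * beta) / 4)) ^+ 2 +
            t `^ (2 * beta) / 4 *
            mittag_leffler (2 * beta) (1 + beta) (- (t `^ (2 * beta) / 4)) ^+ 2).

Definition u (R : realType) (beta x t : R) : R :=
  2 / 3 * (1 + cos (x / 2) *
               mittag_leffler (2 * beta) 1 (- (t `^ (2 * beta) / 4)) +
           sin (x / 2) * (t `^ beta / 2) *
               mittag_leffler (2 * beta) (1 + beta) (- (t `^ (2 * beta) / 4))).

(* Main.v *)
Require Import Defs.
From HB Require Import structures.
From mathcomp Require Import all_boot all_order all_algebra.
From mathcomp Require Import all_classical all_reals all_analysis.
From mathcomp Require Import measurable_realfun ring lra.

(** Both Mittag-Leffler factors of [u] are parts of [E_beta(i x)], [x = t^beta/2].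

    Large times. [E_beta(i x)] is the limit, as [n] tends to infinity, of the
    coefficient [v_n] of [X^n] in [(1-X)^(beta-1) W], where
    [W = ((1-X)^beta - i m)^-1] and [m = x n^(-beta)]. With [A = (1-X)^(beta/2-1)],
    differentiation gives [n v_n = [X^(n-1)] A^2 W (1 + i beta m W)], so by
    Cauchy-Schwarz [v_n] is controlled by the l2 norm of the first [n]
    coefficients of [A], whose square is [O(n^(1-beta))], and by the operator norm
    of [W]. The latter is [O(1/m)] because the numerical range of [(1-X)^beta] lies
    in a sector strictly inside the right half-plane: factoring
    [(1-X)^beta = ((1-X)^(beta/2))^2], this amounts to
    [|(1-X)^(beta/2) f|^2 <= C <(1-X)^beta f, f>], a comparison of two Toeplitz
    forms whose coefficients are explicit. Hence [|E_beta(i x)| <= K / x].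

    Small times. The squared amplitude is a power series in [t^(2 beta)/4] with
    linear coefficient [1/Gamma(1+beta)^2 - 2/Gamma(1+2 beta)], which is negative
    by two applications of Wendel's inequality [Gamma(x+s) <= x^s Gamma(x)]. *)

Set Implicit Arguments.
Unset Strict Implicit.
Unset Printing Implicit Defensive.

Import Order.TTheory GRing.Theory Num.Theory.
Import numFieldNormedType.Exports.

Local Open Scope classical_set_scope.
Local Open Scope ring_scope.

(** [(1-X)^beta] is the backward Grunwald-Letnikov difference, and [(1-X)^(beta-1) W] generates the
    implicit scheme with step [1/n] for the fractional equation of order [beta] with right-hand side
    [i x y], [y(0) = 1]; its solution at time [1] is [E_beta(i x)]. Expanding in [m] produces the
    series [(1-X)^(-1-beta k)], whose rescaled coefficients tend to [1/Gamma(1+beta k)] by Gauss's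
    product. A stability estimate for the scheme thus takes the place of contour integrals. The
    differentiation is essential: splitting [(1-X)^(beta-1)] into two square roots and applying
    Cauchy-Schwarz to [v_n] itself gives only [O(1/m) = O(n^beta/x)], useless as [n] grows. The
    derivative gives [n v_n = O(n^(1-beta)/m)], that is [v_n = O(1/(m n^beta)) = O(1/x)]. Everything
    is kept real: with [D = ((1-X)^(2 beta) + m^2)^-1], the parts of [W] are [(1-X)^beta D] and
    [m D], and they lead to [E_{2 beta}(-x^2)] and [x E_{2 beta,1+beta}(-x^2)]. *)

Section powR_lemmas.
Context {R : realType}.
Implicit Types x y s t : R.

Lemma powR_le_bernoulli y s : 0 < y -> 0 <= s <= 1 -> y `^ s <= 1 + s * (y - 1).
Proof.
move=> y0 /andP[s0 s1]; rewrite /powR gt_eqF//.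
have yE : expR (ln y) = y by rewrite lnK.
set L := ln y in yE *.
have e0 := expR_ge0 (s * L).
(* The tangent to [expR] at [s * L], read at [L] here and at [0] in [h2]; the weights [s] and
   [1 - s] cancel the terms in [L]. *)
have h1 : expR (s * L) * (1 + (1 - s) * L) <= y.
  rewrite -[leRHS]yE (_ : expR L = expR (s * L) * expR ((1 - s) * L)).
    by rewrite ler_wpM2l// expR_ge1Dx.
  by rewrite -expRD -mulrDl addrCA subrr addr0 mul1r.
have h2 : expR (s * L) * (1 - s * L) <= 1.
  rewrite -[leRHS](expRxMexpNx_1 (s * L)) ler_wpM2l//.
  exact: expR_ge1Dx.
have h3 : s * (expR (s * L) * (1 + (1 - s) * L)) <= s * y by rewrite ler_wpM2l.
have h4 : (1 - s) * (expR (s * L) * (1 - s * L)) <= (1 - s) * 1.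
  by rewrite ler_wpM2l// subr_ge0.
lra.
Qed.

(** The inequality [y <= expR y] at [y = s / (2 * x)], raised to the power [x]. Half of the decay of
    [expR (- s)] is left over for integration. *)
Lemma powR_le_expR x s : 0 < x -> 0 < s ->
  s `^ x <= (2 * x) `^ x * expR (s / 2).
Proof.
move=> x0 s0; have x20 : 0 < 2 * x by rewrite mulr_gt0.
have -> : expR (s / 2) = (expR (s / (2 * x))) `^ x.
  by rewrite -expRM; congr expR; field; rewrite gt_eqF.
rewrite -powRM ?expR_ge0 ?(ltW x20)//.
apply: ge0_ler_powR; rewrite ?nnegrE ?mulr_ge0 ?expR_ge0 ?(ltW x0) ?(ltW s0)//.
have h := expR_ge1Dx (s / (2 * x)).
rewrite -(@ler_pM2l _ (2 * x)^-1) ?invr_gt0// mulrA mulVf ?gt_eqF// mul1r.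
by rewrite mulrC (le_trans _ h)// lerDr.
Qed.

End powR_lemmas.

(** * The Gamma function *)

Section gamma.
Context {R : realType}.
Implicit Types x y s t : R.
Local Notation mu := (@lebesgue_measure R).

Definition gamma_integrand x s : R := s `^ (x - 1) * expR (- s).

Lemma gamma_integrand_ge0 x s : 0 <= gamma_integrand x s.
Proof. by rewrite mulr_ge0 ?powR_ge0// expR_ge0. Qed.

Lemma measurable_gamma_integrand x (D : set R) :
  measurable_fun D (gamma_integrand x).
Proof.
apply: measurable_funM; first exact: measurable_funTS.
by apply: measurableT_comp => //; exact: measurableT_comp.
Qed.

Lemma itv0y_bigcup :
  `]0%R, +oo[%classic = \bigcup_n `[n.+1%:R^-1, n.+2%:R : R]%classic.
Proof.
apply/seteqP; split => s /=.
  rewrite in_itv/= andbT => s0.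
  have [m _ /= m_s] : \forall n \near \oo, n.+1%:R^-1 < s.
    have /cvgrPdist_lt/(_ _ s0) := @cvg_harmonic R.
    apply: filterS => n; rewrite sub0r normrN ger0_norm// invr_ge0//.
  pose k := (maxn m (Num.truncn s))%N.
  exists k => //=; rewrite in_itv/= (ltW (m_s k (leq_maxl _ _)))/=.
  apply: ltW; apply: (lt_le_trans (Num.Theory.truncnS_gt s)).
  by rewrite ler_nat ltnS (leq_trans (leq_maxr m _)).
move=> [n _]/=; rewrite !in_itv/= andbT => /andP[+ _]; apply: lt_le_trans.
by rewrite invr_gt0.
Qed.

Lemma cvg_integral_itv0y (f : R -> R) : measurable_fun setT f ->
  (forall s, 0 <= f s) ->
  (\int[mu]_(s in `[(n.+1%:R^-1)%R, n.+2%:R%R]) (f s)%:E @[n --> \oo] -->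
   \int[mu]_(s in `]0%R, +oo[) (f s)%:E)%E.
Proof.
move=> mf f0; rewrite itv0y_bigcup.
apply: (@ge0_nondecreasing_set_cvg_integral _ (measurableTypeR R) R
  (fun n => `[n.+1%:R^-1, n.+2%:R : R]%classic) (fun s => (f s)%:E) mu) => //.
- apply/nondecreasing_seqP => n; apply/subsetPset => s /=.
  rewrite !in_itv/= => /andP[ns sn]; apply/andP; split.
    by rewrite (le_trans _ ns)// lef_pV2 ?posrE// ler_nat.
  by rewrite (le_trans sn)// ler_nat.
- by move=> i; apply/measurable_EFinP; exact: measurable_funTS.
- by move=> i s _; rewrite lee_fin.
Qed.

Lemma integral_itv_derivative (f F : R -> R) a b : 0 < a -> a < b ->
  (forall s, 0 < s -> {for s, continuous f}) ->
  (forall s, 0 < s -> is_derive s 1 F (f s)) ->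
  (\int[mu]_(s in `[a, b]) (f s)%:E = (F b - F a)%:E)%E.
Proof.
move=> a0 ab cf dF; rewrite (continuous_FTC2 (F := F))//.
- apply: continuous_in_subspaceT => s; rewrite inE/= in_itv/= => /andP[as_ _].
  by apply: cf; exact: lt_le_trans as_.
- have cF s : 0 < s -> {for s, continuous F}.
    move=> s0; apply: differentiable_continuous; apply/derivable1_diffP.
    exact: (@ex_derive _ _ _ _ _ _ _ (dF _ s0)).
  split.
  + move=> s; rewrite in_itv/= => /andP[as_ _].
    exact: (@ex_derive _ _ _ _ _ _ _ (dF _ (lt_trans a0 as_))).
  + by apply: cvg_at_right_filter; exact: cF.
  + by apply: cvg_at_left_filter; apply: cF; exact: lt_trans ab.
- move=> s; rewrite in_itv/= => /andP[as_ _].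
  by rewrite derive1E (@derive_val _ _ _ _ _ _ _ (dF _ (lt_trans a0 as_))).
Qed.

Lemma is_derive_powR_expRN (a s : R) : 0 < s ->
  is_derive s 1 (fun s => s `^ a * expR (- s))
    (a * s `^ (a - 1) * expR (- s) - s `^ a * expR (- s)).
Proof.
move=> s0; have dp : is_derive s 1 (fun s => s `^ a) (a * s `^ (a - 1)).
  exact: is_derive1_powR.
have dN : is_derive s (1 : R) (fun s : R => - s) (- 1).
  exact: is_deriveN.
have de : is_derive s 1 (fun s : R => expR (- s)) (- expR (- s)).
  have := @is_derive1_comp _ expR (fun s : R => - s) s _ _
    (is_derive_expR (- s)) dN.
  by rewrite mulrN1.
apply: is_derive_eq (is_deriveM dp de) _.
by rewrite /GRing.scale/= mulrN addrC; congr (_ - _); rewrite mulrC.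
Qed.

Lemma continuous_gamma_integrand x s : 0 < s ->
  {for s, continuous (gamma_integrand x)}.
Proof.
move=> s0; apply: differentiable_continuous; apply/derivable1_diffP.
exact: (@ex_derive _ _ _ _ _ _ _ (is_derive_powR_expRN (x - 1) s0)).
Qed.

(** The boundary term of the integration by parts behind the functional equation of [Gamma]. *)
Definition gamma_boundary x s : R := s `^ x * expR (- s).

Lemma is_derive_gamma_boundary x s : 0 < s ->
  is_derive s 1 (gamma_boundary x)
    (x * gamma_integrand x s - gamma_integrand (x + 1) s).
Proof.
move=> s0; apply: is_derive_eq (is_derive_powR_expRN x s0) _.
by rewrite /gamma_integrand addrK mulrA.
Qed.

Lemma gamma_boundary_ge0 x s : 0 <= gamma_boundary x s.
Proof. by rewrite mulr_ge0 ?powR_ge0 ?expR_ge0. Qed.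

Lemma gamma_boundary_le x s : 0 < x -> 0 < s ->
  gamma_boundary x s <= (2 * x) `^ x * expR (- (s / 2)).
Proof.
move=> x0 s0; rewrite /gamma_boundary.
have -> : - (s / 2) = s / 2 + - s by field.
by rewrite expRD mulrA ler_wpM2r ?expR_ge0 ?powR_le_expR.
Qed.

(* [s |-> s^x e^(-s) / x - C e^(-s/2)] has a derivative above the integrand. *)
Lemma gamma_integral_itv_le x a b : 0 < x -> 0 < a -> a < b ->
  (\int[mu]_(s in `[a, b]) (gamma_integrand x s)%:E <=
   (3 * (2 * x) `^ x / x)%:E)%E.
Proof.
move=> x0 a0 ab; set C := (2 * x) `^ x / x.
have C0 : 0 <= C by rewrite divr_ge0 ?powR_ge0 ?ltW.
pose H s := gamma_boundary x s / x - 2 * C * expR (- (s / 2)).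
pose h s := gamma_integrand x s - gamma_integrand (x + 1) s / x
            + C * expR (- (s / 2)).
have dH s : 0 < s -> is_derive s 1 H (h s).
  move=> s0; have dG := is_derive_gamma_boundary x s0.
  have dN : is_derive s (1 : R) (fun s : R => - (s / 2)) (- 2^-1).
    have := @is_deriveN _ _ _ (fun s : R => s / 2) s 1 2^-1.
    apply; apply: is_derive_eq (is_deriveM (is_derive_id s 1)
      (is_derive_cst (2^-1 : R) s 1)) _.
    by rewrite scaler0 add0r /GRing.scale/= mulr1.
  have de : is_derive s 1 (fun s : R => expR (- (s / 2)))
      (- 2^-1 * expR (- (s / 2))).
    have := @is_derive1_comp _ expR (fun s : R => - (s / 2)) s _ _
      (is_derive_expR (- (s / 2))) dN.
    by rewrite mulrC.
  have dG' : is_derive s 1 (x^-1 *: gamma_boundary x)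
     (x^-1 *: (x * gamma_integrand x s - gamma_integrand (x + 1) s)).
    exact: is_deriveZ.
  have de' : is_derive s 1 ((2 * C) *: (fun s : R => expR (- (s / 2))))
     ((2 * C) *: (- 2^-1 * expR (- (s / 2)))).
    exact: is_deriveZ.
  have := is_deriveB dG' de'.
  have -> : x^-1 *: gamma_boundary x - 2 * C *: (fun s0 : R => expR (- (s0 / 2)))
      = H.
    by apply/funext => r; rewrite /H; congr (_ - _); exact: mulrC.
  move=> dH; apply: is_derive_eq dH _.
  by rewrite /h /GRing.scale/=; field; rewrite gt_eqF.
have ch s : 0 < s -> {for s, continuous h}.
  move=> s0; apply: continuousD; last first.
    apply: continuousM; first exact: cst_continuous.
    apply: continuous_comp; last exact: continuous_expR.
    by apply: continuousN; apply: continuousM; [exact: id|exact: cst_continuous].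
  apply: continuousB; first exact: continuous_gamma_integrand.
  apply: continuousM; last exact: cst_continuous.
  exact: continuous_gamma_integrand.
have gh s : 0 < s -> gamma_integrand x s <= h s.
  move=> s0; rewrite /h -addrA lerDl addrC subr_ge0 /C.
  rewrite ler_pdivrMr// mulrAC divfK ?gt_eqF//.
  rewrite /gamma_integrand addrK.
  exact: gamma_boundary_le.
apply: (@le_trans _ _ (\int[mu]_(s in `[a, b]) (h s)%:E)%E).
  have mh : measurable_fun `[a, b] h.
    apply: measurable_funD; last first.
      apply: measurable_funM => //; apply: measurableT_comp => //.
      by apply: measurableT_comp => //; exact: measurable_funM.
    apply: measurable_funB; first exact: measurable_gamma_integrand.
    by apply: measurable_funM => //; exact: measurable_gamma_integrand.
  apply: ge0_le_integral => //.
  - by move=> s _; rewrite lee_fin gamma_integrand_ge0.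
  - by apply/measurable_EFinP; exact: measurable_gamma_integrand.
  - by apply/measurable_EFinP.
  - move=> s; rewrite /= in_itv/= => /andP[as_ _].
    by rewrite lee_fin gh// (lt_le_trans a0).
rewrite (integral_itv_derivative a0 ab ch dH) lee_fin /H.
have b0 := lt_trans a0 ab.
have e1 s : 0 < s -> expR (- (s / 2)) <= 1.
  by move=> s0; rewrite expR_le1 oppr_le0 divr_ge0// ltW.
have h1 : gamma_boundary x b / x <= C.
  rewrite ler_pM2r ?invr_gt0// (le_trans (gamma_boundary_le x0 b0))//.
  by rewrite ler_piMr ?powR_ge0 ?e1.
have h2 : 0 <= gamma_boundary x a / x by rewrite divr_ge0 ?gamma_boundary_ge0 ?ltW.
have h3 : C * expR (- (a / 2)) <= C by rewrite ler_piMr ?e1.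
have h4 : 0 <= C * expR (- (b / 2)) by rewrite mulr_ge0 ?expR_ge0.
have -> : 3 * (2 * x) `^ x / x = 3 * C by rewrite /C mulrA.
lra.
Qed.

Lemma integrable_gamma_integrand x : 0 < x ->
  mu.-integrable `]0, +oo[ (EFin \o gamma_integrand x).
Proof.
move=> x0; apply/integrableP; split.
  by apply/measurable_EFinP; exact: measurable_gamma_integrand.
under eq_integral do rewrite /= ger0_norm ?gamma_integrand_ge0//.
apply: (@le_lt_trans _ _ (3 * (2 * x) `^ x / x)%:E); last exact: ltry.
have := cvg_integral_itv0y (measurable_gamma_integrand x (D := setT))
  (gamma_integrand_ge0 x).
move=> /lee_cvg_to/(_ (cvg_cst _)); apply.
apply: nearW => n; apply: gamma_integral_itv_le => //; rewrite ?invr_gt0//.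
by rewrite (@le_lt_trans _ _ 1) ?invf_le1 ?ler1n// ltr1n.
Qed.

Lemma integrable_gamma_integrand_itv x (a b : R) : 0 < x -> 0 < a ->
  mu.-integrable `[a, b] (EFin \o gamma_integrand x).
Proof.
move=> x0 a0; apply: (integrableS _ _ _ (integrable_gamma_integrand x0)) => //.
move=> s; rewrite /= !in_itv/= andbT => /andP[+ _]; exact: lt_le_trans.
Qed.

Lemma cvg_Gamma x : 0 < x ->
  \int[mu]_(s in `[n.+1%:R^-1, n.+2%:R]) gamma_integrand x s @[n --> \oo]
  --> Gamma x.
Proof.
move=> x0; apply: fine_cvg.
have := cvg_integral_itv0y (measurable_gamma_integrand x (D := setT))
  (gamma_integrand_ge0 x).
suff <- : ((Gamma x)%:E =
  \int[mu]_(s in `]0%R, +oo[) (gamma_integrand x s)%:E)%E by [].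
rewrite /Gamma /Rintegral fineK//.
exact: (integrable_fin_num _ (integrable_gamma_integrand x0)).
Qed.

Lemma Rintegral_gamma_boundary x (a b : R) : 0 < x -> 0 < a -> a < b ->
  x * (\int[mu]_(s in `[a, b]) gamma_integrand x s) -
  \int[mu]_(s in `[a, b]) gamma_integrand (x + 1) s =
  gamma_boundary x b - gamma_boundary x a.
Proof.
move=> x0 a0 ab; rewrite -RintegralZl//; last exact: integrable_gamma_integrand_itv.
rewrite -RintegralB//; last 2 first.
- exact: (integrableZl _ x (integrable_gamma_integrand_itv _ x0 a0)).
- by apply: integrable_gamma_integrand_itv; rewrite ?addr_gt0.
have ch s : 0 < s -> {for s, continuous
    (fun s => x * gamma_integrand x s - gamma_integrand (x + 1) s)}.
  move=> s0; apply: continuousB; last exact: continuous_gamma_integrand.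
  apply: continuousM; first exact: cst_continuous.
  exact: continuous_gamma_integrand.
by rewrite /Rintegral (integral_itv_derivative a0 ab ch
  (is_derive_gamma_boundary x)).
Qed.

Lemma invS_lt_SS n : n.+1%:R^-1 < n.+2%:R :> R.
Proof. by rewrite (@le_lt_trans _ _ 1) ?invf_le1 ?ler1n// ltr1n. Qed.

(** Integration by parts on [[1/(n+1), n+2]]: the right boundary term vanishes by
    [gamma_boundary_le], the left one because [x > 0]. *)
Lemma GammaS x : 0 < x -> Gamma (x + 1) = x * Gamma x.
Proof.
move=> x0; apply/eqP; rewrite eq_sym -subr_eq0; apply/eqP.
suff [h1 h2] : (gamma_boundary x n.+2%:R - gamma_boundary x n.+1%:R^-1
    @[n --> \oo] --> x * Gamma x - Gamma (x + 1)) /\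
  (gamma_boundary x n.+2%:R - gamma_boundary x n.+1%:R^-1 @[n --> \oo] --> 0).
  exact: (cvg_unique _ h1 h2).
split.
- have E n : gamma_boundary x n.+2%:R - gamma_boundary x n.+1%:R^-1 =
      x * (\int[mu]_(s in `[n.+1%:R^-1, n.+2%:R]) gamma_integrand x s) -
      \int[mu]_(s in `[n.+1%:R^-1, n.+2%:R]) gamma_integrand (x + 1) s.
    by rewrite Rintegral_gamma_boundary ?invr_gt0 ?invS_lt_SS.
  rewrite (eq_cvg _ _ E); apply: cvgB.
    by apply: cvgMl_tmp; exact: cvg_Gamma.
  by apply: cvg_Gamma; rewrite addr_gt0.
- rewrite -[X in _ --> X](subr0 0); apply: cvgB.
    apply: (@squeeze_cvgr _ _ _ _ (fun=> 0)
      (fun n : nat => (2 * x) `^ x * expR (- n%:R) `^ 2^-1)).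
    + apply: nearW => n; rewrite gamma_boundary_ge0/=.
      apply: (le_trans (gamma_boundary_le x0 _)) => //.
      rewrite ler_wpM2l ?powR_ge0// -expRM ler_expR mulNr lerN2.
      by rewrite ler_pM2r// ler_nat (leq_trans (leqnSn _))//.
    + exact: cvg_cst.
    + rewrite -[X in _ --> X](mulr0 ((2 * x) `^ x)); apply: cvgM; first exact: cvg_cst.
      have -> : (fun n : nat => expR (- n%:R) `^ 2^-1) =
          (fun n : nat => Num.sqrt (expR (- n%:R) : R)).
        by apply/funext => n; rewrite powR12_sqrt ?expR_ge0.
      rewrite -[X in _ --> X]sqrtr0.
      apply: continuous_cvg; first exact: sqrt_continuous.
      exact: cvgn_expR.
  apply: (@squeeze_cvgr _ _ _ _ (fun=> 0)
    (fun n : nat => (n.+1%:R^-1) `^ x)).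
  + apply: nearW => n; rewrite gamma_boundary_ge0/= /gamma_boundary.
    by rewrite ler_piMr ?powR_ge0// expR_le1 oppr_le0 invr_ge0.
  + exact: cvg_cst.
  + have /cvg_at_rightP := powR_cvg0 x0; apply; split; last exact: cvg_harmonic.
    by move=> n; rewrite invr_gt0.
Qed.

Lemma Gamma1 : Gamma 1 = 1 :> R.
Proof.
have E n : \int[mu]_(s in `[n.+1%:R^-1, n.+2%:R]) gamma_integrand 1 s =
    expR (- n.+1%:R^-1) - expR (- n.+2%:R).
  have gE : gamma_integrand 1 = fun s : R => expR (- s).
    by apply/funext => s; rewrite /gamma_integrand subrr powRr0 mul1r.
  have cf s : 0 < s -> {for s, continuous (gamma_integrand 1)}.
    by move=> s0; exact: continuous_gamma_integrand.
  have dF s : 0 < s -> is_derive s 1 (- gamma_boundary 0) (gamma_integrand 1 s).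
    move=> s0; have := is_deriveN (is_derive_gamma_boundary 0 s0).
    by rewrite mul0r !add0r opprK.
  rewrite /Rintegral (integral_itv_derivative _ (invS_lt_SS n) cf dF) ?invr_gt0//=.
  have FE s : (- gamma_boundary 0) s = - expR (- s).
    by rewrite fctE /gamma_boundary powRr0 mul1r.
  by rewrite !FE opprK addrC.
have h1 := cvg_Gamma (ltr01 : (0 : R) < 1).
rewrite (eq_cvg _ _ E) in h1.
suff h2 : expR (- n.+1%:R^-1) - expR (- n.+2%:R) @[n --> \oo] --> (1 - 0 : R).
  by rewrite subr0 in h2; exact: (cvg_unique _ h1 h2).
apply: cvgB.
  rewrite -[X in _ --> X](expR0); apply: continuous_cvg; first exact: continuous_expR.
  by rewrite -[X in _ --> X]oppr0; apply: cvgN; exact: cvg_harmonic.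
have := @cvgn_expR R; rewrite -(cvg_shiftn 2).
by apply: cvg_trans; apply: near_eq_cvg; apply: nearW => n /=; rewrite addn2.
Qed.

Lemma Gamma_ge0 x : 0 <= Gamma x.
Proof. by apply: Rintegral_ge0 => s _; exact: gamma_integrand_ge0. Qed.

(* Integrate the weighted AM-GM inequality [t^s <= x^s (1 - s + s t / x)]. *)
Lemma Gamma_wendel x s : 0 < x -> 0 <= s <= 1 ->
  Gamma (x + s) <= x `^ s * Gamma x.
Proof.
move=> x0 s01; have /andP[s0 s1] := s01.
have x10 : 0 < x + 1 by rewrite addr_gt0.
have xs0 : 0 < x + s by rewrite ltr_wpDr.
pose a := x `^ s * (1 - s); pose b := x `^ s * s / x.
have -> : x `^ s * Gamma x = a * Gamma x + b * Gamma (x + 1).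
  by rewrite GammaS// /a /b; field; rewrite gt_eqF.
have i1 := integrable_gamma_integrand x0.
have i2 := integrable_gamma_integrand x10.
rewrite /Gamma -!RintegralZl//.
have i1' : mu.-integrable `]0, +oo[ (EFin \o (fun t => a * gamma_integrand x t)).
  exact: (integrableZl _ a i1).
have i2' : mu.-integrable `]0, +oo[
    (EFin \o (fun t => b * gamma_integrand (x + 1) t)).
  exact: (integrableZl _ b i2).
rewrite -RintegralD//.
apply: le_Rintegral => //.
- exact: (integrable_gamma_integrand xs0).
- exact: (integrableD _ i1' i2').
- move=> t; rewrite /= in_itv/= andbT => t0.
  have -> : x + s - 1 = s + (x - 1) by ring.
  rewrite powRD ?(gt_eqF t0) ?implybT//.
  rewrite /gamma_integrand addrK -(mulr_powRB1 (ltW t0) x0).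
  set P := t `^ (x - 1); set E := expR (- t).
  have -> : a * (P * E) + b * (t * P * E) = (a + b * t) * (P * E) by ring.
  rewrite -mulrA.
  rewrite ler_wpM2r ?mulr_ge0 ?powR_ge0 ?expR_ge0//.
  have -> : a + b * t = x `^ s * (1 + s * (t / x - 1)).
    by rewrite /a /b; field; rewrite gt_eqF.
  have {1}-> : t = x * (t / x) by rewrite mulrC divfK ?gt_eqF.
  rewrite powRM ?divr_ge0 ?(ltW x0) ?(ltW t0)// ler_wpM2l ?powR_ge0//.
  by apply: powR_le_bernoulli => //; rewrite divr_gt0.
Qed.

(** For [0 < y <= 1], Wendel's inequality from [1 + y] up to [2] bounds [Gamma 2 = 1] by a multiple
    of [Gamma (1 + y)], which therefore cannot vanish. The functional equation does the rest. *)
Lemma Gamma_gt0 x : 0 < x -> 0 < Gamma x.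
Proof.
have le1 y : 0 < y <= 1 -> 0 < Gamma y.
  move=> /andP[y0 y1].
  have y10 : 0 < 1 + y by rewrite addr_gt0.
  have G2 : Gamma (1 + y + (1 - y)) = 1 :> R.
    have -> : 1 + y + (1 - y) = 1 + 1 by ring.
    by rewrite GammaS// Gamma1 mulr1.
  have : 0 < Gamma (1 + y).
    rewrite lt_neqAle Gamma_ge0 andbT eq_sym; apply/eqP => G0.
    have := @Gamma_wendel (1 + y) (1 - y) y10.
    rewrite G2 G0 mulr0 subr_ge0 y1 lerBlDr lerDl ltW// => /(_ isT).
    by rewrite real_leNgt ?num_real// ltr01.
  by rewrite addrC GammaS// pmulr_rgt0.
move=> x0; have [n xn] : exists n : nat, x <= n.+1%:R.
  by exists (Num.truncn x); exact/ltW/truncnS_gt.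
elim: n x x0 xn => [|n IHn] x x0 xn; first by rewrite le1// x0.
have [x1|x1] := leP x 1; first by rewrite le1// x0.
have x10 : 0 < x - 1 by rewrite subr_gt0.
rewrite -[x](subrK 1) GammaS// mulr_gt0// IHn//.
by rewrite lerBlDr natr1.
Qed.

(** Wendel's inequality goes from [1 + b] to [1 + 2 * b] and from [1 + b] to [2], where [Gamma] is
    [1]. The exponents [b] and [1 - b] of [1 + b] add up to one, which leaves the factor
    [1 + b < 2]. *)
Lemma Gamma_double_lt (b : R) : 0 < b < 1 ->
  Gamma (1 + 2 * b) < 2 * Gamma (1 + b) ^+ 2.
Proof.
move=> /andP[b0 b1]; have b10 : 0 < 1 + b by rewrite addr_gt0.
have G0 := Gamma_gt0 b10.
have h1 : Gamma (1 + 2 * b) <= (1 + b) `^ b * Gamma (1 + b).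
  have -> : 1 + 2 * b = 1 + b + b by ring.
  by apply: Gamma_wendel; rewrite // !ltW.
have h2 : 1 <= (1 + b) `^ (1 - b) * Gamma (1 + b).
  have := @Gamma_wendel (1 + b) (1 - b) b10.
  have -> : 1 + b + (1 - b) = 1 + 1 by ring.
  by rewrite GammaS// Gamma1 mulr1; apply; apply/andP; split; lra.
have h3 : (1 + b) `^ b * (1 + b) `^ (1 - b) = 1 + b.
  rewrite -powRD ?(gt_eqF b10) ?implybT//.
  by rewrite addrCA subrr addr0 powRr1// ltW.
have p0 : 0 <= (1 + b) `^ b * Gamma (1 + b) by rewrite mulr_ge0 ?powR_ge0 ?ltW.
apply: (le_lt_trans h1); apply: (@le_lt_trans _ _ ((1 + b) * Gamma (1 + b) ^+ 2)).
  have := ler_wpM2l p0 h2; rewrite mulr1 => /le_trans; apply.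
  rewrite -[X in _ <= X * _]h3 le_eqVlt; apply/orP; left; apply/eqP; ring.
by rewrite ltr_pM2r ?exprn_gt0//; lra.
Qed.

End gamma.

(** * Formal power series *)

(** A separate name, so that the ring product is convolution and not the pointwise product of
    functions. *)
Definition fps (R : comNzRingType) := nat -> R.

HB.instance Definition _ (R : comNzRingType) := gen_eqMixin (fps R).
HB.instance Definition _ (R : comNzRingType) := gen_choiceMixin (fps R).

Section fps_ring.
Context {R : comNzRingType}.
Implicit Types f g h : fps R.

Definition fps_zero : fps R := fun=> 0.
Definition fps_one : fps R := fun k => (k == 0%N)%:R.
Definition fps_opp f : fps R := fun k => - f k.
Definition fps_add f g : fps R := fun k => f k + g k.
Definition fps_mul f g : fps R := fun k => \sum_(i < k.+1) f i * g (k - i)%N.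

Lemma fps_addA : associative fps_add.
Proof. by move=> f g h; apply/funext => k; exact: addrA. Qed.

Lemma fps_addC : commutative fps_add.
Proof. by move=> f g; apply/funext => k; exact: addrC. Qed.

Lemma fps_add0 : left_id fps_zero fps_add.
Proof. by move=> f; apply/funext => k; exact: add0r. Qed.

Lemma fps_addN : left_inverse fps_zero fps_opp fps_add.
Proof. by move=> f; apply/funext => k; exact: addNr. Qed.

(** Low coefficients only see truncations, so the ring laws can be inherited from [{poly R}]. *)
Lemma fps_mulE f g n k : (k < n)%N ->
  fps_mul f g k = (\poly_(i < n) f i * \poly_(i < n) g i)`_k.
Proof.
move=> kn; rewrite coefM; apply: eq_bigr => i _; rewrite !coef_poly.
have -> : (i < n)%N by exact: leq_trans (ltn_ord i) kn.
by have -> : (k - i < n)%N by exact: leq_ltn_trans (leq_subr _ _) kn.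
Qed.

Lemma fps_mulC : commutative fps_mul.
Proof.
by move=> f g; apply/funext => k; rewrite !(@fps_mulE _ _ k.+1)// mulrC.
Qed.

Lemma fps_mulA : associative fps_mul.
Proof.
move=> f g h; apply/funext => k.
pose p (u : fps R) := \poly_(i < k.+1) u i.
have L (u : fps R) (q : {poly R}) : (forall i, (i <= k)%N -> u i = q`_i) ->
    forall v, fps_mul u v k = (q * p v)`_k.
  move=> uq v; rewrite coefM; apply: eq_bigr => i _.
  by rewrite uq ?leq_ord// coef_poly ltnS leq_subr.
rewrite (L (fps_mul f g) (p f * p g)); last first.
  by move=> i ik; rewrite (@fps_mulE _ _ k.+1).
rewrite fps_mulC (L (fps_mul g h) (p g * p h)); last first.
  by move=> i ik; rewrite (@fps_mulE _ _ k.+1).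
by rewrite mulrC mulrA.
Qed.

Lemma fps_mul1 : left_id fps_one fps_mul.
Proof.
move=> f; apply/funext => k; rewrite /fps_mul big_ord_recl/= subn0 mul1r.
by rewrite big1 ?addr0// => i _; rewrite /fps_one /= mul0r.
Qed.

Lemma fps_mulDl : left_distributive fps_mul fps_add.
Proof.
move=> f g h; apply/funext => k; rewrite /fps_mul /fps_add -big_split/=.
by apply: eq_bigr => i _; rewrite mulrDl.
Qed.

Lemma fps_oner_neq0 : fps_one != fps_zero.
Proof.
by apply/eqP => /(congr1 (fun f : fps R => f 0%N)) /eqP; rewrite oner_eq0.
Qed.

HB.instance Definition _ := GRing.isZmodule.Build (fps R)
  fps_addA fps_addC fps_add0 fps_addN.
HB.instance Definition _ := GRing.Zmodule_isComNzRing.Build (fps R)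
  fps_mulA fps_mulC fps_mul1 fps_mulDl fps_oner_neq0.

Lemma fpsD f g k : (f + g) k = f k + g k. Proof. by []. Qed.
Lemma fpsN f k : (- f) k = - f k. Proof. by []. Qed.
Lemma fpsB f g k : (f - g) k = f k - g k. Proof. by []. Qed.
Lemma fpsM f g k : (f * g) k = \sum_(i < k.+1) f i * g (k - i)%N.
Proof. by []. Qed.
Lemma fps1 k : (1 : fps R) k = (k == 0%N)%:R. Proof. by []. Qed.
Lemma fps0 k : (0 : fps R) k = 0. Proof. by []. Qed.

Lemma fps_sum (I : Type) (r : seq I) (P : pred I) (F : I -> fps R) k :
  (\sum_(i <- r | P i) F i) k = \sum_(i <- r | P i) F i k.
Proof. by elim/big_rec2 : _ => // i x f _ <-. Qed.

Definition fpsC (a : R) : fps R := fun k => if k == 0%N then a else 0.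

Lemma fpsCM a f k : (fpsC a * f) k = a * f k.
Proof.
rewrite fpsM big_ord_recl/= subn0 big1 ?addr0// => i _.
by rewrite /fpsC /= mul0r.
Qed.

Definition fpsX : fps R := fun k => (k == 1%N)%:R.

Lemma fpsXMS f k : (fpsX * f) k.+1 = f k.
Proof.
rewrite fpsM !big_ord_recl/= /fpsX/= mul0r add0r mul1r subSS subn0.
by rewrite big1 ?addr0// => i _; rewrite mul0r.
Qed.

Lemma fpsXM0 f : (fpsX * f) 0%N = 0.
Proof. by rewrite fpsM big_ord1 mul0r. Qed.

(** The derivation [X d/dX], which, unlike [d/dX], shifts no index. *)
Definition euler f : fps R := fun k => k%:R * f k.

Lemma eulerM f g : euler (f * g) = euler f * g + f * euler g.
Proof.
apply/funext => k; rewrite fpsD !fpsM -big_split/= /euler fpsM mulr_sumr.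
apply: eq_bigr => i _; have ik : (i <= k)%N by rewrite -ltnS.
by rewrite -{1}(subnKC ik) natrD mulrDl mulrA mulrCA.
Qed.

Lemma eulerC a : euler (fpsC a) = 0.
Proof. by apply/funext => -[|k]; rewrite /euler /fpsC ?mul0r ?mulr0. Qed.

Lemma eulerD f g : euler (f + g) = euler f + euler g.
Proof. by apply/funext => k; rewrite /euler !fpsD mulrDr. Qed.

Lemma fps_expn_low f n k : f 0%N = 0 -> (k < n)%N -> (f ^+ n) k = 0.
Proof.
move=> f0; elim: n k => // n IH k kn; rewrite exprS fpsM.
rewrite big1// => -[[|i] /= ik] _; first by rewrite f0 mul0r.
by rewrite IH ?mulr0// subnSK// (leq_trans (leq_subr _ _)).
Qed.

End fps_ring.

Arguments fpsC {R} a.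
Arguments fpsX {R}.

(** Geometric series in [N = 1 - f / f 0]. Since [N] has no constant term, [N ^+ j] leaves the
    coefficients below [j] untouched, and each coefficient of the inverse is a finite sum. *)
Lemma fps_inv_exists (F : fieldType) (f : fps F) : f 0%N != 0 ->
  exists g : fps F, f * g = 1.
Proof.
move=> f0; pose N := 1 - fpsC (f 0%N)^-1 * f.
have N0 : N 0%N = 0 by rewrite /N fpsB fps1 fpsCM mulVf ?subrr.
have fE : f = fpsC (f 0%N) * (1 - N).
  rewrite /N opprB addrCA subrr addr0 mulrA -[LHS]mul1r; congr (_ * _).
  apply/funext => k; rewrite fpsCM /fpsC fps1.
  by case: k => [|k]/=; rewrite ?mulr0// mulfV.
pose g : fps F := fun k => (\sum_(j < k.+1) N ^+ j) k.
have gE K i : (i <= K)%N -> g i = (\sum_(j < K.+1) N ^+ j) i.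
  move=> iK; rewrite /g !fps_sum.
  rewrite -(subnKC iK) -addSn big_split_ord/=.
  rewrite [X in _ + X]big1 ?addr0// => j _.
  by rewrite fps_expn_low// ltnS leq_addr.
have g1 : (1 - N) * g = 1.
  apply/funext => k; rewrite fpsM.
  under eq_bigr do rewrite (@gE k) ?leq_subr//.
  rewrite -fpsM -(opprB N 1) mulNr -subrX1 opprB.
  by rewrite fpsB fps_expn_low ?subr0.
exists (fpsC (f 0%N)^-1 * g); rewrite [X in X * _]fE mulrACA g1 mulr1.
by apply/funext => k; rewrite fpsCM /fpsC fps1; case: k => [|k]/=; rewrite ?mulr0// mulfV.
Qed.

(** * The binomial series *)

Section negbin.
Context {R : realType}.
Implicit Types (s t a : R) (k n : nat).

(* the coefficients of [(1 - X)^(-s)] *)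
Definition negbin s : fps R :=
  fun k => \prod_(j < k) ((s + j%:R) / j.+1%:R).

Lemma negbin0 s : negbin s 0%N = 1. Proof. by rewrite /negbin big_ord0. Qed.

Lemma negbinS s k : negbin s k.+1 = negbin s k * ((s + k%:R) / k.+1%:R).
Proof. by rewrite /negbin big_ord_recr. Qed.

Lemma negbin_rec s k : k.+1%:R * negbin s k.+1 = (s + k%:R) * negbin s k.
Proof. by rewrite negbinS; field; rewrite nat1r pnatr_eq0. Qed.

Lemma fps_rec_eq (f h : fps R) (c : nat -> R) : f 0%N = h 0%N ->
  (forall k, k.+1%:R * f k.+1 = c k * f k) ->
  (forall k, k.+1%:R * h k.+1 = c k * h k) -> f = h.
Proof.
move=> fh0 fE hE; apply/funext; elim=> [//|k IH].
apply: (@mulfI _ k.+1%:R); first by rewrite pnatr_eq0.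
by rewrite fE hE IH.
Qed.

(** The Chu-Vandermonde identity: by the Leibniz rule for [euler], the product obeys the first-order
    recurrence that characterizes [negbin (s + t)]. *)
Lemma negbinD s t : negbin (s + t) = negbin s * negbin t.
Proof.
apply: (@fps_rec_eq _ _ (fun k => s + t + k%:R)).
- by rewrite fpsM big_ord1 subn0 !negbin0 mulr1.
- by move=> k; rewrite negbin_rec.
move=> k.
have -> : k.+1%:R * (negbin s * negbin t) k.+1 = euler (negbin s * negbin t) k.+1 by [].
rewrite eulerM fpsD.
have E u v : (euler (negbin u) * negbin v) k.+1 =
    \sum_(i < k.+1) (u + i%:R) * negbin u i * negbin v (k - i)%N.
  rewrite fpsM big_ord_recl /euler mul0r mul0r add0r.
  by apply: eq_bigr => i _; rewrite /= negbin_rec subSS.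
rewrite E [negbin s * _]mulrC E [X in _ + X](reindex_inj rev_ord_inj)/=.
rewrite fpsM mulr_sumr -big_split/=; apply: eq_bigr => i _.
have ik : (i <= k)%N by rewrite -ltnS.
rewrite subSS subKn// natrB//; ring.
Qed.

Lemma euler_negbin s : euler (negbin s) = fpsC s * (fpsX * negbin (s + 1)).
Proof.
apply/funext => -[|k]; rewrite fpsCM ?fpsXM0 ?fpsXMS /euler ?mul0r ?mulr0//.
elim: k => [|k IH]; first by rewrite negbin_rec !negbin0 addr0.
rewrite negbin_rec [in RHS]negbinS mulrA -IH -natr1.
by field; rewrite natr1 pnatr_eq0.
Qed.

Lemma negbin_gt0 s k : 0 < s -> 0 < negbin s k.
Proof.
by move=> s0; apply: prodr_gt0 => i _; rewrite divr_gt0// ltr_wpDr.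
Qed.

Lemma negbin_homo s : 1 <= s -> {homo negbin s : i j / (i <= j)%N >-> i <= j}.
Proof.
move=> s1; apply: (@homo_leq _ _ <=%O) => [//|y x z|k]; first exact: le_trans.
rewrite negbinS ler_peMr// ?(ltW (negbin_gt0 _ (lt_le_trans ltr01 s1)))//.
by rewrite ler_pdivlMr// mul1r -nat1r lerD2r.
Qed.

(** Taking partial sums is multiplication by [(1 - X)^-1], all of whose coefficients are [1]. *)
Lemma sum_negbin s k : \sum_(i < k.+1) negbin s i = negbin (s + 1) k.
Proof.
rewrite negbinD fpsM; apply: eq_bigr => i _; rewrite -[LHS]mulr1; congr (_ * _).
elim: (k - i)%N => [|n IH]; first by rewrite negbin0.
by rewrite negbinS -IH nat1r mul1r divff.
Qed.

Lemma negbinN_lt0 a k : 0 < a < 1 -> negbin (- a) k.+1 < 0.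
Proof.
move=> /andP[a0 a1]; elim: k => [|k IH].
  by rewrite negbinS negbin0 mul1r addr0 divr1 oppr_lt0.
rewrite negbinS nmulr_rlt0// divr_gt0// -natr1.
have := ler0n R k; lra.
Qed.

Lemma sum_negbinN a k : a != 0 ->
  a * \sum_(i < k.+2) negbin (- a) i = - (k.+1%:R - a) * negbin (- a) k.+1.
Proof.
move=> a0; rewrite sum_negbin; elim: k => [|k IH].
  by rewrite !negbinS !negbin0 /= !addr0 !divr1; ring.
rewrite negbinS mulrA IH [in RHS]negbinS; field.
by rewrite -natrD pnatr_eq0.
Qed.

Lemma norm_negbinN_le a k : 0 < a < 1 -> `|negbin (- a) k.+1| <= k.+1%:R^-1.
Proof.
move=> a01; have /andP[a0 a1] := a01.
have h : `|(k.+1%:R * negbin (- a) k.+1)| <= 1.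
  elim: k => [|k IH].
    rewrite negbin_rec negbin0 mulr1 addr0 normrN gtr0_norm//; exact: ltW.
  rewrite negbin_rec normrM (le_trans _ IH)// normrM ler_wpM2r//.
  rewrite !ger0_norm//; last by rewrite -natr1; have := ler0n R k; lra.
  lra.
rewrite -[leRHS]mul1r ler_pdivlMr// mulrC.
by move: h; rewrite normrM ger0_norm.
Qed.

End negbin.

(** * Coercivity of the fractional difference *)

(* [(i - l) + (l - i)] is [|i - l|], by truncated subtraction. *)
Lemma toeplitz_ge0 (R : realFieldType) (psi : nat -> R) n (f : nat -> R) :
  (forall k, psi k.+1 <= 0) ->
  (forall k, psi 0%N / 2 <= \sum_(i < k.+1) psi i) ->
  0 <= \sum_(i < n) \sum_(l < n) psi ((i - l) + (l - i))%N * (f i * f l).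
Proof.
move=> psi0 psiS; pose w (i l : nat) := psi ((i - l) + (l - i))%N.
have wC i l : w i l = w l i by rewrite /w addnC.
(* Row [i] consists of two initial segments of [psi] sharing the diagonal entry; each sums to at
   least [psi 0 / 2]. *)
have row i : (i < n)%N -> 0 <= \sum_(l < n) w i l.
  move=> i_n; have nE : n = (i.+1 + (n - i.+1))%N by rewrite subnKC.
  have -> : \sum_(l < n) w i l = \sum_(k < i.+1) psi k +
      (\sum_(k < (n - i.+1).+1) psi k - psi 0%N).
    rewrite [in LHS]nE big_split_ord/=; congr (_ + _).
      rewrite (reindex_inj rev_ord_inj)/=; apply: eq_bigr => k _.
      have ki : (k <= i)%N by rewrite -ltnS.
      rewrite /w subSS subKn//; congr psi.
      by rewrite -[RHS]addn0; congr (_ + _)%N; apply/eqP; rewrite subn_eq0 leq_subr.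
    rewrite big_ord_recl addrAC subrr add0r; apply: eq_bigr => k _.
    rewrite /w; congr psi; rewrite /= /bump/= add1n.
    by rewrite addSn -addnS addKn (eqP (_ : i - (i + k.+1) == 0)%N)// subn_eq0 leq_addr.
  have := psiS i; have := psiS (n - i.+1)%N; lra.
(* Diagonal dominance: by symmetry of [w] this is the form with [f i * f l] replaced by
   [(f i ^+ 2 + f l ^+ 2) / 2], which can only lower it, as [w i l <= 0] off the diagonal. *)
apply: (@le_trans _ _ (\sum_(i < n) (\sum_(l < n) w i l) * f i ^+ 2)).
  by apply: sumr_ge0 => i _; rewrite mulr_ge0 ?sqr_ge0 ?row.
have -> : \sum_(i < n) (\sum_(l < n) w i l) * f i ^+ 2 =
    \sum_(i < n) \sum_(l < n) w i l * ((f i ^+ 2 + f l ^+ 2) / 2).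
  have E : \sum_(i < n) \sum_(l < n) w i l * f i ^+ 2 =
      \sum_(i < n) \sum_(l < n) w i l * f l ^+ 2.
    rewrite exchange_big/=; apply: eq_bigr => i _; apply: eq_bigr => l _.
    by rewrite wC.
  have -> : \sum_(i < n) \sum_(l < n) w i l * ((f i ^+ 2 + f l ^+ 2) / 2) =
      (\sum_(i < n) \sum_(l < n) w i l * f i ^+ 2 +
       \sum_(i < n) \sum_(l < n) w i l * f l ^+ 2) / 2.
    rewrite -big_split/= mulr_suml; apply: eq_bigr => i _.
    rewrite -big_split/= mulr_suml; apply: eq_bigr => l _; ring.
  rewrite -E -mulr2n -[_ *+ 2]mulr_natr mulfK ?pnatr_eq0//.
  by apply: eq_bigr => i _; rewrite mulr_suml.
apply: ler_sum => i _; apply: ler_sum => l _.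
rewrite -/(w i l); have [->|il] := eqVneq i l.
  by rewrite le_eqVlt; apply/orP; left; apply/eqP; field.
have w0 : w i l <= 0.
  have : ((i - l) + (l - i) != 0)%N by rewrite addn_eq0 !subn_eq0 -eqn_leq.
  by rewrite /w; case: (_ + _)%N.
rewrite ler_wnM2l//; have := sqr_ge0 (f i - f l); rewrite sqrrB; lra.
Qed.

Lemma cvg_sum_ord (R : realType) n (u : 'I_n -> nat -> R) (l : 'I_n -> R) :
  (forall i, u i N @[N --> \oo] --> l i) ->
  \sum_(i < n) u i N @[N --> \oo] --> \sum_(i < n) l i.
Proof.
elim: n u l => [|n IH] u l ul.
  by rewrite big_ord0; under eq_cvg do rewrite big_ord0; exact: cvg_cst.
rewrite big_ord_recr/=; under eq_cvg do rewrite big_ord_recr/=.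
by apply: cvgD => //; exact: IH.
Qed.

Section lag.
Context {R : comNzRingType}.
Implicit Types (a f : fps R).

(** The lower triangular Toeplitz matrix of multiplication by [a]; the test guards against truncated
    subtraction. *)
Definition lag a j i : R := if (i <= j)%N then a (j - i)%N else 0.

Lemma fpsM_lag a f n j : (j < n)%N -> (a * f) j = \sum_(i < n) lag a j i * f i.
Proof.
move=> jn; rewrite mulrC fpsM (big_ord_widen n (fun i => f i * a (j - i)%N))//.
rewrite big_mkcond/=; apply: eq_bigr => i _; rewrite /lag ltnS.
by case: ifP => _; rewrite ?mul0r// mulrC.
Qed.

(** Inner products of columns are autocorrelations of [a], hence depend only on [l - i] once enough
    rows are taken: the Gram matrix is Toeplitz in the limit. *)
Lemma sum_lagM a i l N : (i <= l)%N ->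
  \sum_(j < N + l) lag a j i * lag a j l = \sum_(r < N) a r * a (r + (l - i))%N.
Proof.
move=> il; rewrite addnC big_split_ord/= big1 ?add0r.
  apply: eq_bigr => r _; rewrite /lag leq_addr (leq_trans il) ?leq_addr// mulrC.
  by rewrite addKn -addnBAC// addnC.
by move=> j _; rewrite /lag [(l <= j)%N]leqNgt ltn_ord mulr0.
Qed.

End lag.

Section coercive.
Context {R : realType}.
Variable g : R.
Hypothesis g0 : 0 < g.
Hypothesis g2 : 2 * g < 1.

Local Notation b := (negbin (- g)).
Local Notation B := (negbin (- (2 * g))).

Let g01 : 0 < g < 1. Proof. by rewrite g0/=; move: g0 g2; lra. Qed.
Let g201 : 0 < 2 * g < 1. Proof. by rewrite mulr_gt0//=. Qed.

Definition autocor k N : R := \sum_(r < N) b r * b (r + k)%N.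

(* telescoping with [r b_r b_(r+k)] *)
Lemma autocor_rec k N : (k.+1%:R + g) * autocor k.+1 N =
  (k%:R - g) * autocor k N - N%:R * b N * b (N + k)%N.
Proof.
elim: N => [|N IH]; first by rewrite /autocor !big_ord0 !mulr0 !mul0r subr0.
rewrite /autocor !big_ord_recr/= -!/(autocor _ _) mulrDr IH negbin_rec addSn.
have := negbin_rec (- g) (N + k); rewrite addnS => bE.
have -> : (k.+1%:R + g) * (b N * b (N + k).+1) =
   b N * ((N + k).+1%:R * b (N + k).+1) - (N%:R - g) * b N * b (N + k).+1.
  rewrite -[in (N + k).+1%:R]addnS natrD; ring.
rewrite bE natrD; ring.
Qed.

Lemma autocor0_le N : autocor 0 N <= 2.
Proof.
case: N => [|N]; first by rewrite /autocor big_ord0.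
(* For [r >= 1] one has [-1 <= b r < 0], so [b r ^+ 2 + b r <= 0]; the value [2] comes from
   [r = 0]. *)
have h : autocor 0 N.+1 + \sum_(r < N.+1) b r <= 2.
  elim: N => [|N IH].
    by rewrite /autocor !big_ord1 addn0 negbin0 mulr1.
  have -> : autocor 0 N.+2 = autocor 0 N.+1 + b N.+1 * b N.+1.
    by rewrite /autocor big_ord_recr/= addn0.
  rewrite big_ord_recr/=; apply: le_trans IH.
  have b0 := negbinN_lt0 N g01.
  have : `|b N.+1| <= 1.
    by rewrite (le_trans (norm_negbinN_le N g01))// invf_le1 ?ler1n.
  rewrite ltr0_norm// => b1.
  have : 0 <= - b N.+1 * (1 + b N.+1) by rewrite mulr_ge0//; lra.
  lra.
apply: le_trans h; rewrite lerDl sum_negbin ltW// negbin_gt0//; move: g0 g2; lra.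
Qed.

(** The Fourier coefficients of [|1 - e^(i theta)|^(2 g)], obtained by solving [autocor_rec] without
    its boundary term. Only the value at [0] stays an unevaluated limit. *)
Definition toep k : R :=
  limn (autocor 0) * \prod_(j < k) ((j%:R - g) / (j.+1%:R + g)).

Lemma toepS k : (k.+1%:R + g) * toep k.+1 = (k%:R - g) * toep k.
Proof.
rewrite /toep big_ord_recr/=.
have : k.+1%:R + g != 0 by rewrite gt_eqF// ltr_wpDl.
by move: (k.+1%:R + g) => q q0; field.
Qed.

Lemma cvg_autocor k : autocor k N @[N --> \oo] --> toep k.
Proof.
elim: k => [|k IH].
  rewrite /toep big_ord0 mulr1.
  apply: nondecreasing_is_cvgn.
    apply/nondecreasing_seqP => N; rewrite /autocor big_ord_recr/= lerDl addn0.
    by rewrite -expr2 sqr_ge0.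
  by exists 2 => _ [N _ <-]; exact: autocor0_le.
have kg : k.+1%:R + g != 0 by rewrite gt_eqF// ltr_wpDl.
have -> : toep k.+1 = (k.+1%:R + g)^-1 * ((k%:R - g) * toep k - 0).
  by rewrite subr0 -toepS mulrA mulVf// mul1r.
have E N : autocor k.+1 N = (k.+1%:R + g)^-1 *
    ((k%:R - g) * autocor k N - N%:R * b N * b (N + k)%N).
  by rewrite -autocor_rec mulrA mulVf// mul1r.
rewrite (eq_cvg _ _ E); apply: cvgMl_tmp; apply: cvgB; first exact: cvgMl_tmp.
(* The boundary term is [O(1/N)]: [N%:R * b N] is at most [1] in modulus and [b (N + k)] at most
   [1 / (N + k)]. *)
rewrite -(cvg_shiftS (fun N => N%:R * b N * b (N + k)%N)).
apply: norm_cvg0.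
apply: (@squeeze_cvgr _ _ _ _ (fun=> 0) (fun N : nat => N.+1%:R^-1)).
- apply: nearW => N; rewrite normr_ge0/= normrM normrM ger0_norm//.
  have h1 := norm_negbinN_le N g01; have h2 := norm_negbinN_le (N + k) g01.
  rewrite addSn (le_trans (ler_wpM2l _ h2)) ?mulr_ge0//.
  rewrite -[leRHS]mul1r ler_pM ?mulr_ge0//.
    by rewrite -ler_pdivlMl// mulr1.
  by rewrite lef_pV2 ?posrE// ler_nat ltnS leq_addr.
- exact: cvg_cst.
- exact: cvg_harmonic.
Qed.


Lemma toep0 : toep 0 = limn (autocor 0).
Proof. by rewrite /toep big_ord0 mulr1. Qed.

Lemma toep0_ge0 : 0 <= toep 0.
Proof.
rewrite toep0; apply: limr_ge.
  by rewrite -toep0; exact: cvg_autocor.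
apply: nearW => N.
by apply: sumr_ge0 => r _; rewrite addn0 -expr2 sqr_ge0.
Qed.

(** Both sequences decay like [k^(-1-2g)]: their successive ratios agree up to a factor
    [1 + O(1/k^2)]. The correction is bounded by [1 + c / (x * (x + 1))], and the sum of
    [1 / (x * (x + 1))] telescopes to [1 - 1/x]. *)
Lemma toep_le : exists2 C : R, 0 <= C & forall k, - toep k.+1 <= C * - B k.+1.
Proof.
(* Chosen through [(x - 2 * g) / (1 - 2 * g) >= x] for [x >= 1], with equality at [x = 1]. The
   constant [E] below makes the first step of the induction an equality. *)
pose c := (g + 2 * g ^+ 2) / (1 - 2 * g).
have g20 : 0 < 1 - 2 * g by rewrite subr_gt0.
have c0 : 0 <= c.
  by rewrite divr_ge0 ?(ltW g20)// addr_ge0 ?mulr_ge0 ?sqr_ge0 ?ltW.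
pose E := toep 0 / (2 * (1 + g)).
have g10 : 0 < 1 + g by rewrite addr_gt0.
have E0 : 0 <= E by rewrite divr_ge0 ?toep0_ge0 ?mulr_ge0// ltW.
have h k : - toep k.+1 <= E * expR (c * (1 - k.+1%:R^-1)) * - B k.+1.
  elim: k => [|k IH].
    rewrite invr1 subrr mulr0 expR0 mulr1 negbinS negbin0 mul1r addr0 divr1 opprK.
    have /(canRL (mulKf (lt0r_neq0 g10))) -> := toepS 0.
    rewrite /E sub0r le_eqVlt; apply/orP; left; apply/eqP; field.
    exact: lt0r_neq0.
  set x : R := k.+1%:R; have x1 : 1 <= x by rewrite ler1n.
  have x0 : 0 < x by rewrite ltr0n.
  have xE : k.+2%:R = x + 1 by rewrite natr1.
  have -> : - toep k.+2 = - toep k.+1 * ((x - g) / (x + 1 + g)).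
    have : x + 1 + g != 0 by rewrite gt_eqF// !addr_gt0.
    have := toepS k.+1; rewrite xE -/x => /[swap] q0 /(canRL (mulKf q0)) ->.
    ring.
  have -> : - B k.+2 = - B k.+1 * ((x - 2 * g) / (x + 1)).
    by rewrite negbinS -/x xE mulNr [- _ + x]addrC.
  have xg : 0 <= (x - g) / (x + 1 + g).
    by rewrite divr_ge0//; move: g0 g2 x1; lra.
  apply: (le_trans (ler_wpM2r xg IH)).
  have B0 : 0 <= - B k.+1 by rewrite oppr_ge0 ltW// negbinN_lt0.
  rewrite xE (_ : c * (1 - (x + 1)^-1) = c * (1 - x^-1) + c / (x * (x + 1))); last first.
    by field; rewrite !gt_eqF// addr_gt0.
  rewrite expRD; set e1 := expR (c * (1 - x^-1)).
  set e3 := expR (c / (x * (x + 1))).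
  have -> : E * (e1 * e3) * (- B k.+1 * ((x - 2 * g) / (x + 1))) =
    E * e1 * - B k.+1 * (e3 * ((x - 2 * g) / (x + 1))) by ring.
  rewrite ler_wpM2l// ?(mulr_ge0 (mulr_ge0 E0 (expR_ge0 _)) B0)//.
  have xg2 : 0 <= (x - 2 * g) / (x + 1) by rewrite divr_ge0//; move: g2 x1; lra.
  apply: le_trans (ler_wpM2r xg2 (expR_ge1Dx (c / (x * (x + 1))))).
  rewrite ler_pdivrMr; last by rewrite !addr_gt0.
  rewrite -subr_ge0.
  have -> : (1 + c / (x * (x + 1))) * ((x - 2 * g) / (x + 1)) * (x + 1 + g) - (x - g)
     = ((c * (x - 2 * g) * (x + 1 + g)) / (x * (x + 1)) - (g + 2 * g ^+ 2)) / (x + 1).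
    by field; rewrite !gt_eqF// addr_gt0.
  rewrite divr_ge0//; last by rewrite ltW// addr_gt0.
  rewrite subr_ge0 ler_pdivlMr; last by rewrite mulr_gt0// addr_gt0.
  have -> : c * (x - 2 * g) * (x + 1 + g) =
    (g + 2 * g ^+ 2) * ((x - 2 * g) / (1 - 2 * g) * (x + 1 + g)).
    by rewrite /c; field; rewrite gt_eqF.
  rewrite ler_wpM2l ?addr_ge0 ?mulr_ge0 ?sqr_ge0 ?(ltW g0)//.
  rewrite ler_pM ?(ltW x0) ?addr_ge0 ?(ltW x0)//; last by rewrite lerDl ltW.
  rewrite ler_pdivlMr// mulrBr mulr1 lerD2l lerN2 -[leLHS]mul1r.
  by rewrite ler_wpM2r// mulr_ge0 ?ltW.
exists (E * expR c); first by rewrite mulr_ge0 ?expR_ge0.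
move=> k; apply: (le_trans (h k)); rewrite ler_wpM2r//.
  by rewrite oppr_ge0 ltW// negbinN_lt0.
by rewrite ler_wpM2l// ler_expR ler_piMr// gerBl invr_ge0.
Qed.

Lemma sum_toep k : 2 * g * \sum_(i < k.+1) toep i =
  g * toep 0 - (k%:R - g) * toep k.
Proof.
elim: k => [|k IH]; first by rewrite big_ord1; ring.
by rewrite big_ord_recr/= mulrDr IH -toepS -natr1; ring.
Qed.

Lemma sum_B k : 2 * g * \sum_(i < k.+1) B i = - (k%:R - 2 * g) * B k.
Proof.
case: k => [|k]; first by rewrite big_ord1; ring.
by rewrite sum_negbinN// gt_eqF// mulr_gt0.
Qed.

(** Multiplication by [B] plus its transpose, as a symmetric Toeplitz matrix; the diagonal entry
    [B 0 = 1] is doubled. *)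
Let sym k : R := if k == 0%N then 2 else B k.

Lemma toep_form_le : exists2 C : R, 0 <= C & forall n (f : nat -> R),
  2 * \sum_(i < n) \sum_(l < n) toep ((i - l) + (l - i))%N * (f i * f l) <=
  C * \sum_(i < n) \sum_(l < n) sym ((i - l) + (l - i))%N * (f i * f l).
Proof.
have [C C0 hC] := toep_le.
have g20 : 0 < 1 - 2 * g by rewrite subr_gt0.
(* In the partial-sum condition of [toeplitz_ge0], the summand [toep 0] settles [k = 0] and the
   other one [k >= 1], because [(x - g) * (1 - 2 * g) <= x - 2 * g] for [x >= 1]. *)
pose K := 2 * C / (1 - 2 * g) + toep 0.
have C'0 : 0 <= 2 * C / (1 - 2 * g) by rewrite divr_ge0 ?mulr_ge0// ltW.
have KC : 2 * C <= K.
  apply: (@le_trans _ _ (2 * C / (1 - 2 * g))); last by rewrite lerDl toep0_ge0.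
  by rewrite ler_pdivlMr// ler_piMr ?mulr_ge0// gerBl mulr_ge0// ltW.
have K0 : 0 <= K by rewrite addr_ge0 ?toep0_ge0.
exists K => // n f.
rewrite -subr_ge0.
pose psi k := K * sym k - 2 * toep k.
have := @toeplitz_ge0 R psi n f.
have -> : \sum_(i < n) \sum_(l < n) psi ((i - l) + (l - i))%N * (f i * f l) =
  K * \sum_(i < n) \sum_(l < n) sym ((i - l) + (l - i))%N * (f i * f l) -
  2 * \sum_(i < n) \sum_(l < n) toep ((i - l) + (l - i))%N * (f i * f l).
  rewrite !mulr_sumr -sumrB; apply: eq_bigr => i _.
  rewrite !mulr_sumr -sumrB; apply: eq_bigr => l _.
  by rewrite /psi; ring.
apply.
- move=> k; rewrite /psi /sym/=; have := hC k; have := negbinN_lt0 k g201 => Bk hk.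
  have : 2 * C * - B k.+1 <= K * - B k.+1 by rewrite ler_wpM2r// oppr_ge0 ltW.
  lra.
- move=> k; rewrite -(@ler_pM2l _ (2 * g)) ?mulr_gt0// -subr_ge0.
  have -> : \sum_(i < k.+1) psi i = K * (\sum_(i < k.+1) B i + 1) -
      2 * \sum_(i < k.+1) toep i.
    have -> : \sum_(i < k.+1) B i + 1 = \sum_(i < k.+1) sym i.
      by rewrite !big_ord_recl/= /sym/= negbin0 addrAC.
    by rewrite !mulr_sumr -sumrB.
  have -> : 2 * g * (K * (\sum_(i < k.+1) B i + 1) - 2 * \sum_(i < k.+1) toep i)
      - 2 * g * (psi 0%N / 2) =
    K * (2 * g * \sum_(i < k.+1) B i) - 2 * (2 * g * \sum_(i < k.+1) toep i)
     + 2 * g * toep 0.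
    by rewrite /psi /sym/=; field.
  rewrite sum_B sum_toep.
  have -> : K * (- (k%:R - 2 * g) * B k) - 2 * (g * toep 0 - (k%:R - g) * toep k)
    + 2 * g * toep 0 = K * (k%:R - 2 * g) * - B k - 2 * (k%:R - g) * - toep k by ring.
  case: k => [|k].
    rewrite negbin0 /K; have := C'0; have := g0 => ? ?.
    have : 0 <= 2 * g * (2 * C / (1 - 2 * g)) by rewrite mulr_ge0// mulr_ge0// ltW.
    lra.
  rewrite subr_ge0; set x : R := k.+1%:R; have x1 : 1 <= x by rewrite ler1n.
  have xg : 0 <= 2 * (x - g) by move: g0 g2 x1; lra.
  apply: (le_trans (ler_wpM2l xg (hC k))); rewrite mulrA ler_wpM2r//.
    by rewrite oppr_ge0 ltW// negbinN_lt0.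
  apply: (@le_trans _ _ (2 * C / (1 - 2 * g) * (x - 2 * g))); last first.
    rewrite ler_wpM2r//; first by move: g2 x1; lra.
    by rewrite lerDl toep0_ge0.
  have -> : 2 * C / (1 - 2 * g) * (x - 2 * g) =
    2 * C * ((x - 2 * g) / (1 - 2 * g)) by ring.
  have -> : 2 * (x - g) * C = 2 * C * (x - g) by ring.
  rewrite ler_wpM2l ?mulr_ge0// ler_pdivlMr//.
  have : 0 <= g * (1 - 2 * g) by rewrite mulr_ge0 ?ltW.
  have : 0 <= g * (x - 1) by rewrite mulr_ge0 ?(ltW g0)// subr_ge0.
  lra.
Qed.


Lemma cvg_lag i l : \sum_(j < N) lag b j i * lag b j l @[N --> \oo] -->
  toep ((i - l) + (l - i))%N.
Proof.
wlog il : i l / (i <= l)%N => [h|].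
  have [il|/ltnW li] := leqP i l; first exact: h.
  rewrite addnC; under eq_cvg do under eq_bigr do rewrite mulrC.
  exact: h.
rewrite (eqP (_ : i - l == 0)%N) ?subn_eq0// add0n.
rewrite -(cvg_shiftn l) (eq_cvg _ _ (fun N => sum_lagM b N il)).
exact: cvg_autocor.
Qed.

Lemma fractional_coercive : exists2 C : R, 0 <= C & forall n (f : fps R),
  \sum_(j < n) (b * f) j ^+ 2 <= C * \sum_(j < n) (B * f) j * f j.
Proof.
have [C C0 hC] := toep_form_le; exists C => // n f.
have BE : 2 * \sum_(j < n) (B * f) j * f j =
    \sum_(i < n) \sum_(l < n) sym ((i - l) + (l - i))%N * (f i * f l).
  have E : \sum_(j < n) (B * f) j * f j =
      \sum_(i < n) \sum_(l < n) lag B i l * (f i * f l).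
    apply: eq_bigr => i _; rewrite (fpsM_lag _ _ (ltn_ord i)) mulr_suml.
    by apply: eq_bigr => l _; rewrite -mulrA [f l * _]mulrC.
  rewrite mulr2n mulrDl mul1r {1}E E [X in X + _]exchange_big/= -big_split/=.
  apply: eq_bigr => i _; rewrite -big_split/=; apply: eq_bigr => l _.
  rewrite [f l * f i]mulrC -mulrDl; congr (_ * _); rewrite /lag /sym.
  rewrite addn_eq0 !subn_eq0.
  case: (ltngtP i l) => [il|li|->]/=.
  - by rewrite (eqP (_ : i - l == 0)%N) ?subn_eq0 1?ltnW// addr0.
  - by rewrite (eqP (_ : l - i == 0)%N) ?subn_eq0 1?ltnW// add0r addn0.
  - by rewrite subnn negbin0.
(* [b] times [f] cut off after [n] coefficients, the same as [b * f] below [n]. Summing squares over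
   all [j] only adds nonnegative terms, and it makes the Gram matrix exactly [toep]. *)
pose F j := \sum_(i < n) lag b j i * f i.
have FE (j : 'I_n) : (b * f) j = F j by exact: fpsM_lag.
have cvgF : \sum_(j < N) F j ^+ 2 @[N --> \oo] -->
    \sum_(i < n) \sum_(l < n) toep ((i - l) + (l - i))%N * (f i * f l).
  have E N : \sum_(j < N) F j ^+ 2 = \sum_(i < n) \sum_(l < n)
      (\sum_(j < N) lag b j i * lag b j l) * (f i * f l).
    under eq_bigr do rewrite /F expr2 big_distrlr/=.
    rewrite exchange_big/=; apply: eq_bigr => i _.
    rewrite exchange_big/=; apply: eq_bigr => l _.
    by rewrite mulr_suml; apply: eq_bigr => j _; rewrite mulrACA.
  rewrite (eq_cvg _ _ E); apply: cvg_sum_ord => i; apply: cvg_sum_ord => l.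
  by apply: cvgMr_tmp; exact: cvg_lag.
rewrite -(@ler_pM2l _ 2)// mulrCA BE; apply: le_trans (hC n f).
rewrite ler_pM2l//; apply: (cvgr_to_ge cvgF).
exists n => // N /= nN; under eq_bigr do rewrite FE.
rewrite -(subnKC nN) big_split_ord/= lerDl.
by apply: sumr_ge0 => j _; exact: sqr_ge0.
Qed.

End coercive.

(** * Resolvent estimate on the imaginary axis *)

Section dotn.
Context {R : realType}.
Implicit Types (f h : fps R) (n : nat).

Definition dotn n f h : R := \sum_(i < n) f i * h i.
Definition sqn n f : R := \sum_(i < n) f i ^+ 2.

Lemma sqn_ge0 n f : 0 <= sqn n f.
Proof. by apply: sumr_ge0 => i _; exact: sqr_ge0. Qed.

Lemma dotnC n f h : dotn n f h = dotn n h f.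
Proof. by apply: eq_bigr => i _; rewrite mulrC. Qed.

Lemma dotnDl n f1 f2 h : dotn n (f1 + f2) h = dotn n f1 h + dotn n f2 h.
Proof. by rewrite -big_split; apply: eq_bigr => i _; rewrite fpsD mulrDl. Qed.

Lemma dotnBl n f1 f2 h : dotn n (f1 - f2) h = dotn n f1 h - dotn n f2 h.
Proof. by rewrite -sumrB; apply: eq_bigr => i _; rewrite fpsB mulrBl. Qed.

Lemma dotnCl n a f h : dotn n (fpsC a * f) h = a * dotn n f h.
Proof. by rewrite mulr_sumr; apply: eq_bigr => i _; rewrite fpsCM mulrA. Qed.

Lemma dotn_sqn n f : dotn n f f = sqn n f.
Proof. by []. Qed.

Lemma norm_sum_mul_le n (x y : 'I_n -> R) e : 0 < e ->
  `|\sum_(i < n) x i * y i| <=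
  (e * \sum_(i < n) y i ^+ 2 + (\sum_(i < n) x i ^+ 2) / e) / 2.
Proof.
move=> e0; apply: (le_trans (ler_norm_sum _ _ _)).
rewrite mulr_sumr [X in _ + X]mulr_suml -big_split/= mulr_suml.
apply: ler_sum => i _; rewrite normrM.
have -> : x i ^+ 2 = `|x i| ^+ 2 by rewrite real_normK ?num_real.
have -> : y i ^+ 2 = `|y i| ^+ 2 by rewrite real_normK ?num_real.
set a := `|x i|; set b := `|y i|.
rewrite -subr_ge0.
have -> : (e * b ^+ 2 + a ^+ 2 / e) / 2 - a * b = (e * b - a) ^+ 2 / (2 * e).
  by field; rewrite gt_eqF.
by rewrite divr_ge0 ?sqr_ge0// mulr_ge0// ltW.
Qed.

Lemma dotn_le n f h e : 0 < e ->
  `|dotn n f h| <= (e * sqn n h + sqn n f / e) / 2.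
Proof. exact: norm_sum_mul_le. Qed.

(** Turns a pairing of the first [n + 1] coefficients into one coefficient of a product, so that
    factors move across by commutativity. Values beyond [n] are never read. *)
Definition fps_rev n h : fps R := fun k => h (n - k)%N.

Lemma dotn_rev n f h : dotn n.+1 f h = (f * fps_rev n h) n.
Proof.
by rewrite fpsM; apply: eq_bigr => i _; rewrite /fps_rev subKn// -ltnS.
Qed.

Lemma fpsM_rev2 n f h : (f * fps_rev n (fps_rev n h)) n = (f * h) n.
Proof.
by rewrite !fpsM; apply: eq_bigr => i _; rewrite /fps_rev subKn// leq_subr.
Qed.

Lemma norm_fpsM_le n f h e : 0 < e ->
  `|(f * h) n| <= (e * sqn n.+1 h + sqn n.+1 f / e) / 2.
Proof.
move=> e0; rewrite fpsM; apply: (le_trans (norm_sum_mul_le _ _ e0)).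
rewrite (_ : \sum_(i < n.+1) h (n - i)%N ^+ 2 = sqn n.+1 h)//.
rewrite (reindex_inj rev_ord_inj)/=; apply: eq_bigr => i _.
by rewrite subSS subKn// -ltnS.
Qed.

End dotn.

Section resolvent.
Context {R : realType}.
Variable beta : R.
Hypothesis beta01 : 0 < beta < 1.

Local Notation B := (negbin (- beta)).

(** The sector condition in polarized form. With [b = (1-X)^(beta/2)], the pairing is a coefficient
    of [b f] times [b] applied to the reversal of [h]; Young's inequality and [fractional_coercive]
    bound both squares. The quadratic form of [B] is invariant under reversal. *)
Lemma fractional_form_bounded : exists2 C : R, 0 <= C & forall n (f h : fps R),
  `|dotn n (B * f) h| <= C * (dotn n (B * f) f + dotn n (B * h) h).
Proof.
have /andP[b0 b1] := beta01.
have g0 : 0 < beta / 2 by rewrite divr_gt0.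
have bE : 2 * (beta / 2) = beta by field.
have [|C C0 hC] := @fractional_coercive R (beta / 2) g0.
  by rewrite bE.
rewrite bE in hC; exists (C / 2); first by rewrite divr_ge0.
case=> [|n] f h; first by rewrite /dotn !big_ord0 normr0 addr0 mulr0.
have Bbb : B = negbin (- (beta / 2)) * negbin (- (beta / 2)).
  by rewrite -negbinD; congr negbin; field.
have -> : dotn n.+1 (B * f) h =
    (negbin (- (beta / 2)) * f * (negbin (- (beta / 2)) * fps_rev n h)) n.
  by rewrite dotn_rev Bbb -!mulrA (mulrCA f).
apply: (le_trans (norm_fpsM_le _ _ _ ltr01)).
have -> : dotn n.+1 (B * h) h = dotn n.+1 (B * fps_rev n h) (fps_rev n h).
  by rewrite !dotn_rev fpsM_rev2 mulrAC.
rewrite mul1r divr1 mulrAC ler_pM2r ?invr_gt0// mulrDr addrC.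
by apply: lerD; exact: hC.
Qed.

(** The equations say [(B - i m)(g1 + i g2) = f1 + i f2]. Paired with [g1 + i g2], the real part
    controls the form of [B], and the imaginary part gives [m] times the squared norm up to cross
    terms, which the sector condition bounds by that form. *)
Lemma resolvent_bound : exists2 K : R, 0 < K & forall m n (f1 f2 g1 g2 : fps R),
  0 < m -> B * g1 + fpsC m * g2 = f1 -> B * g2 - fpsC m * g1 = f2 ->
  m ^+ 2 * (sqn n g1 + sqn n g2) <= K * (sqn n f1 + sqn n f2).
Proof.
have [C C0 hC] := fractional_form_bounded.
(* Two cross terms cost [C * S] each and the pairing with [f] costs [S]. Young's weight [m / T]
   makes half of [m * N] appear in [T * S], where it is absorbed. *)
pose T := 2 * C + 1; have T0 : 0 < T by rewrite ltr_wpDl// mulr_ge0.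
exists (T ^+ 2); first by rewrite exprn_gt0.
move=> m n f1 f2 g1 g2 m0 E1 E2.
set X := dotn n (B * g1) g1 + dotn n (B * g2) g2.
have e0 : 0 < m / T by rewrite divr_gt0.
set N := sqn n g1 + sqn n g2; set F := sqn n f1 + sqn n f2.
pose S := (m / T * N + F / (m / T)) / 2.
have hX : X <= S.
  have -> : X = dotn n f1 g1 + dotn n f2 g2.
    rewrite -E1 -E2 dotnBl dotnDl !dotnCl [dotn n g2 g1]dotnC /X; ring.
  have h1 := le_trans (ler_norm _) (dotn_le n f1 g1 e0).
  have h2 := le_trans (ler_norm _) (dotn_le n f2 g2 e0).
  by rewrite /S /N /F mulrDr (mulrDl (sqn n f1)); lra.
have hY : `|dotn n f2 g1 - dotn n f1 g2| <= S.
  apply: (le_trans (ler_normB _ _)).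
  have h1 := dotn_le n f2 g1 e0; have h2 := dotn_le n f1 g2 e0.
  by rewrite /S /N /F mulrDr (mulrDl (sqn n f1)); lra.
have mN : m * N = dotn n (B * g2) g1 - dotn n (B * g1) g2 -
    (dotn n f2 g1 - dotn n f1 g2).
  rewrite -E1 -E2 dotnBl dotnDl !dotnCl !dotn_sqn /N; ring.
have : m * N <= T * S.
  rewrite mN.
  have h1 : dotn n (B * g2) g1 <= C * X.
    by rewrite /X addrC; exact: le_trans (ler_norm _) (hC n g2 g1).
  have h2 : - dotn n (B * g1) g2 <= C * X.
    by apply: le_trans (hC n g1 g2); rewrite -normrN ler_norm.
  have h3 : - (dotn n f2 g1 - dotn n f1 g2) <= S.
    by apply: le_trans hY; rewrite -normrN ler_norm.
  have h4 : C * X <= C * S by rewrite ler_wpM2l.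
  rewrite /T; lra.
have -> : T * S = (m * N + T ^+ 2 * F / m) / 2.
  by rewrite /S; field; rewrite !gt_eqF.
move=> h; have : m * N <= T ^+ 2 * F / m by lra.
by rewrite ler_pdivlMr// expr2 mulrAC.
Qed.

End resolvent.

(** * Growth of binomial coefficients and of their l2 norms *)

Section negbin_bounds.
Context {R : realType}.
Implicit Types (g beta : R) (k n : nat).

(** With [x = k + 1], the induction step is [(1 - g/x) (1 + 1/x)^g <= 1]; Bernoulli's inequality
    bounds the left side by [1 - (g/x)^2]. *)
Lemma negbin_subr_le g k : 0 < g < 1 -> negbin (1 - g) k <= k.+1%:R `^ (- g).
Proof.
move=> /andP[g0 g1]; elim: k => [|k IH]; first by rewrite negbin0 powR1.
set x : R := k.+1%:R; have x0 : 0 < x by rewrite ltr0n.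
have x1 : 1 <= x by rewrite ler1n.
have xE : k.+2%:R = x + 1 by rewrite natr1.
have xg : 0 <= (x - g) / x by rewrite divr_ge0 ?(ltW x0)// subr_ge0; lra.
rewrite negbinS -addrA [- g + _]addrC addrA nat1r -/x xE.
apply: (le_trans (ler_wpM2r xg IH)).
have -> : x + 1 = x * (1 + x^-1) by field; rewrite gt_eqF.
have y0 : 0 < 1 + x^-1 by rewrite addr_gt0 ?invr_gt0.
rewrite powRM ?(ltW x0) ?(ltW y0)// ler_wpM2l ?powR_ge0// powRN.
rewrite -[leRHS]mul1r ler_pdivlMr ?powR_gt0//.
have h : (1 + x^-1) `^ g <= 1 + g * (1 + x^-1 - 1).
  by apply: powR_le_bernoulli => //; rewrite !ltW.
apply: (le_trans (ler_wpM2l xg h)).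
have -> : (x - g) / x * (1 + g * (1 + x^-1 - 1)) = 1 - (g / x) ^+ 2.
  by field; rewrite gt_eqF.
by rewrite gerBl sqr_ge0.
Qed.

(** The squares are at most [(j + 1)^(-beta)]. Comparison with the integral of [s^(-beta)] is done
    by induction, Bernoulli's inequality standing for concavity of the power [1 - beta]. *)
Lemma sqn_negbin_le beta n : 0 < beta < 1 ->
  sqn n (negbin (1 - beta / 2)) <= n%:R `^ (1 - beta) / (1 - beta).
Proof.
move=> /andP[b0 b1]; have b10 : 0 < 1 - beta by rewrite subr_gt0.
elim: n => [|n IH].
  by rewrite /sqn big_ord0 divr_ge0 ?powR_ge0// ltW.
rewrite /sqn big_ord_recr/= -/(sqn n _).
set x : R := n.+1%:R; have x0 : 0 < x by rewrite ltr0n.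
have h1 : negbin (1 - beta / 2) n ^+ 2 <= x `^ (- beta).
  have -> : x `^ (- beta) = (x `^ (- (beta / 2))) ^+ 2.
    by rewrite -powR_mulrn ?powR_ge0// -powRrM; congr powR; field.
  have n0 : 0 <= negbin (1 - beta / 2) n by rewrite ltW// negbin_gt0//; lra.
  rewrite ler_pXn2r ?nnegrE ?powR_ge0//.
  by apply: negbin_subr_le; apply/andP; split; lra.
apply: (le_trans (lerD IH h1)).
rewrite ler_pdivlMr// mulrDl divfK ?gt_eqF//.
have xb : x `^ (- beta) = x `^ (1 - beta) / x.
  rewrite powRD ?(gt_eqF x0) ?implybT// powRr1 ?(ltW x0)//.
  by rewrite mulrAC divff ?gt_eqF// mul1r.
have h2 : n%:R `^ (1 - beta) <= x `^ (1 - beta) * (1 + (1 - beta) * (n%:R / x - 1)).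
  case: n @x x0 {IH h1 xb} => [|n] x x0.
    rewrite powR0 ?gt_eqF// mulr_ge0 ?powR_ge0// mul0r; lra.
  have -> : n.+1%:R `^ (1 - beta) = x `^ (1 - beta) * (n.+1%:R / x) `^ (1 - beta).
    rewrite -powRM ?divr_ge0 ?(ltW x0)//; congr (_ `^ _).
    by rewrite mulrC divfK ?gt_eqF.
  rewrite ler_wpM2l ?powR_ge0// powR_le_bernoulli ?divr_gt0//.
  by apply/andP; split; lra.
apply: (le_trans (lerD h2 (lexx _))); rewrite xb.
have -> : n%:R = x - 1 by rewrite /x -natr1 addrK.
rewrite le_eqVlt; apply/orP; left; apply/eqP; field.
by rewrite gt_eqF.
Qed.

End negbin_bounds.

(** * The coefficients of the scheme on the imaginary axis *)

Section coef_bound.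
Context {R : realType}.
Variable beta : R.
Hypothesis beta01 : 0 < beta < 1.

Local Notation B := (negbin (- beta)).
Local Notation A := (negbin (1 - beta / 2)).
Local Notation C := (negbin (1 - beta)).

Lemma fpsC1B (a : R) : fpsC (1 - a) = 1 - fpsC a.
Proof. by apply/funext => -[|k]; rewrite fpsB fps1 /fpsC/= ?subr0. Qed.

Lemma fpsCN (a : R) : fpsC (- a) = - fpsC a.
Proof. by apply/funext => -[|k]; rewrite fpsN /fpsC/= ?oppr0. Qed.

Lemma negbin_sqr : C * C = A * A * B.
Proof. by rewrite -!negbinD; congr negbin; field. Qed.

(* Differentiating [V = (1 - X)^(beta-1) W], [W = ((1 - X)^beta - i m)^-1],
   gives [V' = A^2 W (1 + i beta m W)]; here are its real and imaginary parts. *)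
Lemma euler_resolvent (M D : fps R) (bt := fpsC beta) : euler M = 0 ->
  (B * B + M * M) * D = 1 ->
  euler (B * D * C) =
    fpsX * (A * (B * D * A - bt * M * (2 * (B * D * (M * D) * A)))) /\
  euler (M * D * C) =
    fpsX * (A * (M * D * A + bt * M * (B * D * (B * D) * A - M * D * (M * D) * A))).
Proof.
move=> M0 H.
have dB : euler B = - (bt * (fpsX * C)) by rewrite euler_negbin fpsCN mulNr addrC.
have dC : euler C = (1 - bt) * (fpsX * (A * A)).
  by rewrite euler_negbin fpsC1B -negbinD; congr (_ * (_ * negbin _)); field.
have dD : euler D = 2 * bt * fpsX * B * C * D * D.
  have : euler ((B * B + M * M) * D) = 0.
    rewrite H; apply/funext => -[|k]; first by rewrite /euler mul0r.
    by rewrite /euler fps1 mulr0.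
  rewrite eulerM eulerD !eulerM M0 dB => h.
  have -> : euler D = D * ((B * B + M * M) * euler D).
    by rewrite mulrA [D * _]mulrC H mul1r.
  move/eqP: h; rewrite addrC addr_eq0 => /eqP ->; ring.
(* Once [C * C] is traded for [A * A * B], the difference of the two sides is in both cases a
   multiple of this vanishing expression. *)
have H0 : (B * B + M * M) * D - 1 = 0 by rewrite H subrr.
split; apply/eqP; rewrite -subr_eq0; apply/eqP.
- rewrite !eulerM dB dC dD.
  have -> : (- (bt * (fpsX * C)) * D + B * (2 * bt * fpsX * B * C * D * D)) * C +
    B * D * ((1 - bt) * (fpsX * (A * A))) -
    fpsX * (A * (B * D * A - bt * M * (2 * (B * D * (M * D) * A)))) =
    - bt * fpsX * D * (C * C) + 2 * bt * fpsX * B * B * D * D * (C * C) +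
    B * D * ((1 - bt) * (fpsX * (A * A))) -
    fpsX * (A * (B * D * A - bt * M * (2 * (B * D * (M * D) * A)))) by ring.
  rewrite negbin_sqr.
  transitivity (2 * bt * fpsX * A * A * B * D * ((B * B + M * M) * D - 1)).
    ring.
  by rewrite H0 mulr0.
- rewrite !eulerM M0 dC dD.
  have -> : (0 * D + M * (2 * bt * fpsX * B * C * D * D)) * C +
    M * D * ((1 - bt) * (fpsX * (A * A))) -
    fpsX * (A * (M * D * A + bt * M * (B * D * (B * D) * A - M * D * (M * D) * A))) =
    M * (2 * bt * fpsX * B * D * D) * (C * C) +
    M * D * ((1 - bt) * (fpsX * (A * A))) -
    fpsX * (A * (M * D * A + bt * M * (B * D * (B * D) * A - M * D * (M * D) * A)))
    by ring.
  rewrite negbin_sqr.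
  transitivity (bt * fpsX * A * A * M * D * ((B * B + M * M) * D - 1)).
    ring.
  by rewrite H0 mulr0.
Qed.

Lemma sqnD_le n (f h : fps R) : sqn n (f + h) <= 2 * sqn n f + 2 * sqn n h.
Proof.
rewrite /sqn !mulr_sumr -big_split/=; apply: ler_sum => i _; rewrite fpsD.
have := sqr_ge0 (f i - h i); lra.
Qed.

Lemma sqnC n a (f : fps R) : sqn n (fpsC a * f) = a ^+ 2 * sqn n f.
Proof.
by rewrite /sqn mulr_sumr; apply: eq_bigr => i _; rewrite fpsCM exprMn.
Qed.

Lemma resolvent_coef_bound : exists2 K : R, 0 < K & forall m n (D : fps R),
  0 < m -> (B * B + fpsC m * fpsC m) * D = 1 ->
  `|(B * D * C) n.+1| <= K / (m * n.+1%:R `^ beta) /\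
  `|(fpsC m * D * C) n.+1| <= K / (m * n.+1%:R `^ beta).
Proof.
have /andP[b0 b1] := beta01; have b10 : 0 < 1 - beta by rewrite subr_gt0.
have [K K0 hK] := resolvent_bound beta01.
(* Bounds [m^2] times the squared norm of [(W + i beta m W^2) A] relative to that of [A]: [K] for
   [W], [K ^+ 2] for [W^2], each doubled by [sqnD_le]. *)
pose L := 2 * K + 2 * K ^+ 2.
have L0 : 0 < L by rewrite addr_gt0 ?mulr_gt0// ?exprn_gt0.
exists ((1 + L) / (2 * (1 - beta))); first by rewrite divr_gt0 ?addr_gt0 ?mulr_gt0.
move=> m n D m0 H.
set M := fpsC m in H *.
have [E1 E2] := euler_resolvent (eulerC m) H.
have m20 : 0 < m ^+ 2 by rewrite exprn_gt0.
set N := sqn n.+1 A; have N0 : 0 <= N by exact: sqn_ge0.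
(* [Y1 + i Y2 = W A] and [Z1 + i Z2 = W^2 A], so the resolvent bound is used twice, with data [A]
   and then [Y]. *)
set Y1 := B * D * A in E1; set Y2 := M * D * A in E2.
set Z2 := 2 * (B * D * (M * D) * A) in E1.
set Z1 := B * D * (B * D) * A - M * D * (M * D) * A in E2.
have sq0 : sqn n.+1 (0 : fps R) = 0.
  by rewrite /sqn big1// => i _; rewrite fps0 expr2 mul0r.
have hY : m ^+ 2 * (sqn n.+1 Y1 + sqn n.+1 Y2) <= K * N.
  have := @hK m n.+1 A 0 Y1 Y2 m0; rewrite sq0 addr0; apply.
  - by rewrite -/M /Y1 /Y2 -[RHS]mul1r -H; ring.
  - by rewrite -/M /Y1 /Y2; ring.
have hZ : m ^+ 2 * (sqn n.+1 Z1 + sqn n.+1 Z2) <=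
    K * (sqn n.+1 Y1 + sqn n.+1 Y2).
  apply: hK => //.
  - transitivity ((B * B + M * M) * D * Y1); last by rewrite H mul1r.
    by rewrite -/M /Y1 /Z1 /Z2; ring.
  - transitivity ((B * B + M * M) * D * Y2); last by rewrite H mul1r.
    by rewrite -/M /Y2 /Z1 /Z2; ring.
have sY1 := sqn_ge0 n.+1 Y1; have sY2 := sqn_ge0 n.+1 Y2.
have sZ1 := sqn_ge0 n.+1 Z1; have sZ2 := sqn_ge0 n.+1 Z2.
have key (Y Z : fps R) : sqn n.+1 Y <= sqn n.+1 Y1 + sqn n.+1 Y2 ->
    sqn n.+1 Z <= sqn n.+1 Z1 + sqn n.+1 Z2 ->
    `|(A * (Y + fpsC (beta * m) * Z)) n| <= (1 + L) / (2 * m) * N.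
  move=> hY1 hZ1; have m'0 : 0 < m by [].
  apply: (le_trans (norm_fpsM_le n _ _ m0)); rewrite -/N.
  have h1 := sqnD_le n.+1 Y (fpsC (beta * m) * Z); rewrite sqnC in h1.
  have h2 : m ^+ 2 * sqn n.+1 Y <= K * N by apply: le_trans hY; rewrite ler_pM2l.
  have h3 : m ^+ 2 * (m ^+ 2 * sqn n.+1 Z) <= K ^+ 2 * N.
    apply: (@le_trans _ _ (m ^+ 2 * (K * (sqn n.+1 Y1 + sqn n.+1 Y2)))).
      by rewrite ler_pM2l//; apply: le_trans hZ; rewrite ler_pM2l.
    by rewrite mulrCA expr2 -[leRHS]mulrA ler_pM2l.
  have h4 : (beta * m) ^+ 2 * sqn n.+1 Z <= m ^+ 2 * sqn n.+1 Z.
    rewrite ler_wpM2r ?sqn_ge0// exprMn ler_piMl ?(ltW m20)//.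
    by rewrite expr_le1// ltW.
  have h5 : m ^+ 2 * sqn n.+1 (Y + fpsC (beta * m) * Z) <= L * N.
    apply: (@le_trans _ _ (m ^+ 2 * (2 * sqn n.+1 Y + 2 * (m ^+ 2 * sqn n.+1 Z)))).
      by rewrite ler_pM2l// (le_trans h1)// lerD2l ler_pM2l.
    by rewrite /L mulrDl mulrDr; lra.
  have -> : (1 + L) / (2 * m) * N = (L * N / m + N / m) / 2.
    by field; rewrite gt_eqF.
  rewrite ler_pM2r ?invr_gt0// lerD2r ler_pdivlMr// mulrC mulrA -expr2.
  exact: h5.
have hN : N <= n.+1%:R `^ (1 - beta) / (1 - beta) by exact: sqn_negbin_le.
have x0 : 0 < n.+1%:R :> R by [].
have fin (v : fps R) (w : R) : n.+1%:R * v n.+1 = w ->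
    `|w| <= (1 + L) / (2 * m) * N ->
    `|v n.+1| <= (1 + L) / (2 * (1 - beta)) / (m * n.+1%:R `^ beta).
  move=> vw hw; rewrite -(ler_pM2l x0) -[X in X * `|_|](ger0_norm (ltW x0)) -normrM vw.
  apply: (le_trans hw).
  have -> : n.+1%:R * ((1 + L) / (2 * (1 - beta)) / (m * n.+1%:R `^ beta)) =
    (1 + L) / (2 * m) * (n.+1%:R / n.+1%:R `^ beta / (1 - beta)).
    by field; rewrite !gt_eqF ?powR_gt0.
  have c0 : 0 <= (1 + L) / (2 * m).
    by apply: ltW; apply: divr_gt0; [exact: addr_gt0|exact: mulr_gt0].
  rewrite ler_wpM2l//; apply: (le_trans hN); rewrite powRD ?(gt_eqF x0) ?implybT//.
  by rewrite powRr1 ?ler0n// powRN.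
have btM : fpsC beta * M = fpsC (beta * m).
  by apply/funext => k; rewrite fpsCM /M /fpsC; case: (k == 0)%N; rewrite ?mulr0.
split.
- have := congr1 (fun f : fps R => f n.+1) E1; rewrite /= fpsXMS => e1.
  apply: fin e1 _; rewrite -(mulrN _ Z2) btM; apply: key; first by rewrite lerDl.
  rewrite (_ : sqn _ (- Z2) = sqn n.+1 Z2) ?lerDr//.
  by apply: eq_bigr => i _; rewrite fpsN sqrrN.
- have := congr1 (fun f : fps R => f n.+1) E2; rewrite /= fpsXMS => e2.
  apply: fin e2 _; rewrite btM; apply: key; last by rewrite lerDl.
  by rewrite lerDr.
Qed.

End coef_bound.

(** * Binomial coefficients and the Gamma function *)

Section rbin.
Context {R : realType}.
Implicit Types (x y : R) (n k : nat).

(** Gauss's product for [1 / Gamma (1 + y)]. *)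
Definition rbin y n : R := negbin (1 + y) n * n%:R `^ (- y).

Lemma rbin_gt0 y n : 0 <= y -> 0 < rbin y n.+1.
Proof. by move=> y0; rewrite mulr_gt0 ?powR_gt0// negbin_gt0// ltr_wpDr. Qed.

(** Reduces to [ln ((x + 1) / x) >= 1 / (x + 1)]. Monotonicity lets a bound at one index dominate
    all later ones and the limit. *)
Lemma rbinS_le y n : 0 <= y -> rbin y n.+2 <= rbin y n.+1.
Proof.
move=> y0; have n0 : 0 <= negbin (1 + y) n.+1 by rewrite ltW// negbin_gt0// ltr_wpDr.
rewrite /rbin negbinS -mulrA ler_wpM2l//.
set x : R := n.+1%:R; have x0 : 0 < x by rewrite ltr0n.
have x10 : 0 < x + 1 by rewrite addr_gt0.
have -> : n.+2%:R = x + 1 by rewrite natr1.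
rewrite !powRN ler_pdivrMr ?powR_gt0//.
rewrite [leRHS]mulrC ler_pdivlMr ?powR_gt0//.
have q0 : 0 < (x + 1) / x by rewrite divr_gt0.
have -> : (x + 1) `^ y = ((x + 1) / x) `^ y * x `^ y.
  by rewrite -powRM ?(ltW q0) ?(ltW x0)// divfK ?gt_eqF.
rewrite ler_wpM2r ?powR_ge0// /powR gt_eqF//.
apply: le_trans (expR_ge1Dx _).
have -> : (1 + y + x) / (x + 1) = 1 + y * (x + 1)^-1 by field; rewrite gt_eqF.
rewrite lerD2l ler_wpM2l//.
have -> : ln ((x + 1) / x) = - ln (1 + (- (x + 1)^-1)).
  have -> : 1 + - (x + 1)^-1 = ((x + 1) / x)^-1.
    by field; rewrite !gt_eqF.
  by rewrite lnV ?opprK.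
rewrite lerNr; apply: le_ln1Dx.
by rewrite ltrN2 invf_lt1// ltrDr.
Qed.

Lemma rbin_le y m n : 0 <= y -> (m <= n)%N -> rbin y n.+1 <= rbin y m.+1.
Proof.
move=> y0; elim: n => [|n IH]; first by rewrite leqn0 => /eqP ->.
rewrite leq_eqVlt => /predU1P[->//|]; rewrite ltnS => /IH.
by apply: le_trans; exact: rbinS_le.
Qed.

Lemma Gamma_negbin x n : 0 < x ->
  Gamma x * negbin x n * Gamma (1 + n%:R) = Gamma (x + n%:R).
Proof.
move=> x0; elim: n => [|n IH].
  by rewrite negbin0 !addr0 Gamma1 !mulr1.
rewrite -natr1 !addrA !GammaS ?ltr_wpDr// -IH negbinS -natr1.
by field; rewrite natr1 pnatr_eq0.
Qed.

Lemma cvg_Gamma_ratio y : 0 <= y ->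
  Gamma (1 + n.+1%:R + y) / (Gamma (1 + n.+1%:R) * n.+1%:R `^ y)
  @[n --> \oo] --> (1 : R).
Proof.
have le1 s : 0 <= s <= 1 ->
    Gamma (1 + n.+1%:R + s) / (Gamma (1 + n.+1%:R) * n.+1%:R `^ s)
    @[n --> \oo] --> (1 : R).
  move=> s01; have /andP[s0 s1] := s01.
  apply: (@squeeze_cvgr _ _ _ _ (fun n => 1 - n.+1%:R^-1) (fun n => 1 + n.+1%:R^-1)).
  - apply: nearW => n; set x : R := n.+1%:R.
    have x0 : 0 < x by rewrite ltr0n.
    have x10 : 0 < 1 + x by rewrite addr_gt0.
    have x1s0 : 0 < 1 + x + s by rewrite ltr_wpDr.
    have G0 := Gamma_gt0 x10; have p0 : 0 < x `^ s by rewrite powR_gt0.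
    apply/andP; split.
      rewrite ler_pdivlMr ?mulr_gt0//.
      (* Lower bound: Wendel's inequality from [1 + x + s] reaches [2 + x], where the functional
         equation brings back [Gamma (1 + x)]. *)
      have h := @Gamma_wendel R (1 + x + s) (1 - s) x1s0.
      have {h} : Gamma (1 + x + 1) <= (1 + x + s) `^ (1 - s) * Gamma (1 + x + s).
        have -> : 1 + x + 1 = 1 + x + s + (1 - s) by ring.
        by apply: h; apply/andP; split; lra.
      rewrite GammaS// powRD ?(gt_eqF x1s0) ?implybT// powRr1 ?(ltW x1s0)// powRN.
      rewrite mulrAC ler_pdivlMr ?powR_gt0// => h.
      rewrite -(ler_pM2l x1s0); apply: le_trans h.
      rewrite [X in X <= _](_ : _ = (1 + x + s) * (1 - x^-1) * x `^ s * Gamma (1 + x));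
        last by ring.
      rewrite [leRHS]mulrAC ler_wpM2r ?(ltW G0)// ler_pM ?powR_ge0//.
      + rewrite mulr_ge0 ?(ltW x1s0)// subr_ge0 invf_le1// ler1n//.
      + have -> : (1 + x + s) * (1 - x^-1) = 1 + x - (1 - s + (1 + s) / x).
          by field; rewrite gt_eqF.
        rewrite gerBl addr_ge0 ?subr_ge0// divr_ge0 ?(ltW x0)// addr_ge0//.
      + apply: ge0_ler_powR => //; rewrite ?nnegrE ?(ltW x0) ?(ltW x1s0)//; lra.
    rewrite ler_pdivrMr ?mulr_gt0//.
    apply: (le_trans (Gamma_wendel x10 s01)).
    rewrite [leRHS]mulrCA mulrC ler_wpM2l ?(ltW G0)//.
    have -> : 1 + x = (1 + x^-1) * x by field; rewrite gt_eqF.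
    have q1 : 1 <= 1 + x^-1 by rewrite lerDl invr_ge0 ltW.
    rewrite powRM ?(ltW x0) ?(le_trans ler01 q1)// ler_wpM2r ?powR_ge0//.
    exact: ler1_powR.
  - rewrite -[X in _ --> X]subr0; apply: cvgB; first exact: cvg_cst.
    exact: cvg_harmonic.
  - rewrite -[X in _ --> X]addr0; apply: cvgD; first exact: cvg_cst.
    exact: cvg_harmonic.
move=> y0; have [k yk] : exists k : nat, y <= k.+1%:R.
  by exists (Num.truncn y); exact/ltW/truncnS_gt.
elim: k y y0 yk => [|k IH] y y0 yk; first by apply: le1; rewrite y0.
have [y1|y1] := leP y 1; first by apply: le1; rewrite y0.
have y10 : 0 <= y - 1 by rewrite subr_ge0 ltW.
have E n : Gamma (1 + n.+1%:R + y) / (Gamma (1 + n.+1%:R) * n.+1%:R `^ y) =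
   Gamma (1 + n.+1%:R + (y - 1)) / (Gamma (1 + n.+1%:R) * n.+1%:R `^ (y - 1)) *
   (1 + y * n.+1%:R^-1).
  set x : R := n.+1%:R; have x0 : 0 < x by rewrite ltr0n.
  have -> : 1 + x + y = 1 + x + (y - 1) + 1 by ring.
  rewrite GammaS; last by rewrite ltr_wpDr// addr_gt0.
  have -> : x `^ y = x `^ (y - 1) * x.
    by rewrite mulrC mulr_powRB1 ?(ltW x0)// (lt_trans ltr01).
  have G0 : Gamma (1 + x) != 0 by rewrite gt_eqF// Gamma_gt0// addr_gt0.
  have p0 : x `^ (y - 1) != 0 by rewrite gt_eqF// powR_gt0.
  by clearbody x; field; rewrite p0 G0 gt_eqF.
rewrite (eq_cvg _ _ E).
have h1 := IH _ y10; rewrite lerBlDr natr1 in h1.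
have h2 : 1 + y * n.+1%:R^-1 @[n --> \oo] --> 1 + y * 0.
  by apply: cvgD; [exact: cvg_cst|apply: cvgMl_tmp; exact: cvg_harmonic].
have h3 := cvgM (h1 yk) h2.
by rewrite (_ : 1 * (1 + y * 0) = 1) in h3; [exact: h3|rewrite mulr0 addr0 mulr1].
Qed.

Lemma cvg_rbin y : 0 <= y -> rbin y n.+1 @[n --> \oo] --> (Gamma (1 + y))^-1.
Proof.
move=> y0; have y10 : 0 < 1 + y by rewrite ltr_wpDr.
have E n : rbin y n.+1 = Gamma (1 + n.+1%:R + y) /
    (Gamma (1 + n.+1%:R) * n.+1%:R `^ y) * (Gamma (1 + y))^-1.
  rewrite addrAC -Gamma_negbin// /rbin powRN.
  have G0 : Gamma (1 + y) != 0 by rewrite gt_eqF// Gamma_gt0.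
  have G1 : Gamma (1 + n.+1%:R : R) != 0 by rewrite gt_eqF// Gamma_gt0// addr_gt0.
  have p0 : n.+1%:R `^ y != 0 :> R by rewrite gt_eqF// powR_gt0.
  move: (Gamma (1 + n.+1%:R)) (n.+1%:R `^ y) G1 p0 => G p G1 p0.
  by field; rewrite G0 G1 p0.
rewrite (eq_cvg _ _ E).
have h := cvgMr_tmp (b := (Gamma (1 + y))^-1) (cvg_Gamma_ratio y0).
by rewrite (mul1r (Gamma (1 + y))^-1) in h; exact: h.
Qed.

Lemma invGamma_le y n : 0 <= y -> (Gamma (1 + y))^-1 <= rbin y n.+1.
Proof.
move=> y0; apply: (cvgr_to_le (cvg_rbin y0)).
by exists n => // k /= nk; exact: rbin_le.
Qed.

(** The term of degree [d + 1] in the exponential series at [(k + 1) * ln 2]. *)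
Lemma exprn_le_2expn d : exists2 K : R, 0 < K &
  forall k, k.+1%:R ^+ d.+1 <= K * 2 ^+ k.
Proof.
have l0 : 0 < ln 2 :> R by rewrite ln_gt0// ltr1n.
exists (2 * (d.+1)`!%:R / ln 2 ^+ d.+1).
  by rewrite divr_gt0 ?mulr_gt0 ?exprn_gt0// ltr0n fact_gt0.
move=> k; have kl0 : 0 <= k.+1%:R * ln 2 :> R by rewrite mulr_ge0// ltW.
have := expR_ge1Dxn d kl0.
rewrite expRM_natl lnK ?posrE// => h.
rewrite mulrAC ler_pdivlMr ?exprn_gt0// -exprMn.
have F0 : 0 < (d.+1)`!%:R :> R by rewrite ltr0n fact_gt0.
rewrite mulrAC -ler_pdivrMr// -exprS (le_trans _ h)//.
by rewrite lerDr.
Qed.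

(** Fix [d] with [(d + 1)^a >= 4 x]. At index [d + 1] the powers give [4^(-k)], while the binomial
    factor is polynomial in [k], hence [O(2^k)]. The result is a majorant uniform in [n], and
    through [invGamma_le] also one for the Mittag-Leffler series. *)
Lemma rbin_geometric_le x (a : R) : 0 < x -> 0 < a < 1 ->
  exists n0, exists2 K : R, 0 < K & forall n k, (n0 <= n)%N ->
    x ^+ k * rbin (a * k%:R) n.+1 <= K * 2^-1 ^+ k.
Proof.
move=> x0 /andP[a0 a1].
have [d hd] : exists d : nat, 4 * x <= d.+1%:R `^ a.
  exists (Num.truncn ((4 * x) `^ a^-1)).
  rewrite [leLHS](_ : _ = ((4 * x) `^ a^-1) `^ a); last first.
    by rewrite -powRrM mulVf ?lt0r_neq0// powRr1// mulr_ge0// ltW.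
  by apply: ge0_ler_powR; rewrite ?nnegrE ?powR_ge0 ?(ltW a0) ?(ltW (truncnS_gt _)).
have [K K0 hK] := exprn_le_2expn d.
exists d, K => // n k dn.
have ak0 : 0 <= a * k%:R by rewrite mulr_ge0// ltW.
have xk0 : 0 <= x ^+ k by rewrite exprn_ge0// ltW.
apply: (le_trans (ler_wpM2l xk0 (rbin_le ak0 dn))).
have h1 : negbin (1 + a * k%:R) d.+1 <= k.+1%:R ^+ d.+1.
  rewrite /negbin -[d.+1 in leRHS]card_ord -prodr_const.
  apply: ler_prod => j _; apply/andP; split.
    by rewrite divr_ge0// !addr_ge0.
  rewrite ler_pdivrMr// -[j.+1%:R]natr1 -[k.+1%:R]natr1.
  have : a * k%:R <= k%:R by rewrite ler_piMl// ltW.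
  have : 0 <= k%:R * j%:R :> R by rewrite mulr_ge0.
  lra.
rewrite /rbin; have -> : d.+1%:R `^ (- (a * k%:R)) = ((d.+1%:R `^ a) ^+ k)^-1.
  by rewrite powRN powRrM powR_mulrn ?powR_ge0.
have h2 : ((d.+1%:R `^ a) ^+ k)^-1 <= ((4 * x) ^+ k)^-1.
  rewrite lef_pV2 ?posrE ?exprn_gt0 ?mulr_gt0 ?powR_gt0//.
  by apply: lerXn2r; rewrite ?nnegrE ?powR_ge0 ?mulr_ge0 ?(ltW x0).
apply: (@le_trans _ _ (x ^+ k * (K * 2 ^+ k * ((4 * x) ^+ k)^-1))).
  rewrite ler_wpM2l// ler_pM ?invr_ge0 ?exprn_ge0 ?powR_ge0//.
    by rewrite ltW// negbin_gt0// ltr_wpDr.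
  exact: le_trans h1 (hK k).
rewrite exprMn (_ : 4 = 2 * 2 :> R); last by rewrite -natrM.
rewrite exprMn exprVn le_eqVlt; apply/orP; left; apply/eqP.
by field; rewrite !expf_neq0// gt_eqF.
Qed.

End rbin.

(** * The Mittag-Leffler function *)

Section mittag_leffler.
Context {R : realType}.
Variable beta : R.
Hypothesis beta01 : 0 < beta < 1.

Let beta0 : 0 < beta. Proof. by case/andP: beta01. Qed.

Local Notation idx p l := (p + 2 * l)%N.

Lemma mlE p l : 2 * beta * l%:R + (1 + beta * p%:R) = 1 + beta * (idx p l)%:R.
Proof. by rewrite natrD natrM; ring. Qed.

(** [p = 0] and [p = 1] give the even and the odd coefficients of [E_beta]. *)
Definition ml_coef p l : R := (Gamma (2 * beta * l%:R + (1 + beta * p%:R)))^-1.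

Lemma ml_coef_gt0 p l : 0 < ml_coef p l.
Proof. by rewrite /ml_coef mlE invr_gt0 Gamma_gt0// ltr_wpDr// mulr_ge0// ltW. Qed.

Lemma ml_coef_le p (r : R) : 0 <= r ->
  exists2 K : R, 0 < K & forall l, r ^+ l * ml_coef p l <= K * 4^-1 ^+ l.
Proof.
move=> r0; have x0 : 0 < r + 1 by rewrite ltr_wpDl.
have [n0 [K K0 hK]] := rbin_geometric_le x0 beta01.
exists K => // l; have b0 : 0 <= beta * (idx p l)%:R by rewrite mulr_ge0// ltW.
have x1 : 1 <= r + 1 by rewrite lerDr.
apply: (@le_trans _ _ ((r + 1) ^+ idx p l * rbin (beta * (idx p l)%:R) n0.+1)).
  rewrite ler_pM ?exprn_ge0 ?(ltW (ml_coef_gt0 _ _))//; last first.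
    by rewrite /ml_coef mlE invGamma_le.
  apply: (@le_trans _ _ ((r + 1) ^+ (2 * l))).
    rewrite exprM; apply: lerXn2r; rewrite ?nnegrE ?exprn_ge0 ?(ltW x0)//.
    by rewrite expr2; have := mulr_ge0 r0 r0; lra.
  by apply: ler_weXn2l => //; exact: leq_addl.
apply: (le_trans (hK _ _ (leqnn _))); rewrite ler_pM2l// exprD exprM.
rewrite (_ : 2^-1 ^+ 2 = 4^-1); last by rewrite exprVn -natrX.
by rewrite ler_piMl ?exprn_ge0// exprn_ile1// invf_le1// ler1n.
Qed.

Lemma cvg_geometric4 (K : R) : K * 4^-1 ^+ l @[l --> \oo] --> (0 : R).
Proof.
rewrite -(mulr0 K); apply: cvgMl_tmp; apply: cvg_expr.
by rewrite ger0_norm// invf_lt1// ltr1n.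
Qed.

Lemma cvg_mittag_leffler p z :
  \sum_(l < n) z ^+ l * ml_coef p l @[n --> \oo] -->
  mittag_leffler (2 * beta) (1 + beta * p%:R) z.
Proof.
pose u l := z ^+ l / Gamma (2 * beta * l%:R + (1 + beta * p%:R)).
have : cvgn (series u).
  apply: normed_cvg.
  have [K K0 hK] := ml_coef_le p (normr_ge0 z).
  apply: (@series_le_cvg _ _ (geometric K 4^-1)) => [l|l|l|].
  - exact: normr_ge0.
  - by rewrite /geometric/= mulr_ge0 ?exprn_ge0// ltW.
  - rewrite /= /u normrM normrX.
    by rewrite (ger0_norm (ltW (ml_coef_gt0 p l))).
  - by apply: is_cvg_geometric_series; rewrite ger0_norm// invf_lt1// ltr1n.
move=> h; have -> : (fun n => \sum_(l < n) z ^+ l * ml_coef p l) = series u.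
  by apply/funext => n; rewrite /series/= big_mkord.
exact: h.
Qed.

Local Notation B := (negbin (- beta)).

(** Iterates [D = B^-2 - m^2 B^-2 D]. As [m] is a number and not a formal variable, the remainder is
    kept exactly and must be estimated. *)
Lemma resolvent_expand (m : R) (D : fps R) (s : R) L :
  (B * B + fpsC m * fpsC m) * D = 1 ->
  D * negbin s = \sum_(l < L) fpsC ((- m ^+ 2) ^+ l) * negbin (s + 2 * beta * l.+1%:R)
    + fpsC ((- m ^+ 2) ^+ L) * (D * negbin (s + 2 * beta * L%:R)).
Proof.
move=> H; have CM (a b : R) : fpsC (a * b) = fpsC a * fpsC b.
  by apply/funext => k; rewrite fpsCM /fpsC; case: (k == 0)%N; rewrite ?mulr0.
elim: L => [|L IH].
  rewrite big_ord0 add0r mulr0 addr0 expr0.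
  by rewrite (_ : fpsC 1 = 1) ?mul1r//; apply/funext => -[].
rewrite big_ord_recr/= {1}IH -[RHS]addrA; congr (_ + _).
rewrite (exprSr (- m ^+ 2) L) CM -(mulrA (fpsC ((- m ^+ 2) ^+ L))) -mulrDr; congr (_ * _).
set t := s + 2 * beta * L.+1%:R.
have -> : negbin (s + 2 * beta * L%:R) = B * B * negbin t.
  by rewrite -!negbinD; congr negbin; rewrite /t -natr1; ring.
have -> : fpsC (- m ^+ 2) = - (fpsC m * fpsC m) by rewrite fpsCN expr2 CM.
transitivity ((B * B + fpsC m * fpsC m) * D * negbin t -
  fpsC m * fpsC m * (D * negbin t)); first by ring.
by rewrite H mul1r mulNr.
Qed.

Section fixed_argument.
Variable x : R.
Hypothesis x0 : 0 < x.
Variable p : nat.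

(** The [l]-th Neumann term of the coefficient of index [n + 1], with [mesh n] in the role of
    [m]. *)
Let term n l : R := (-1) ^+ l * (x ^+ idx p l * rbin (beta * (idx p l)%:R) n.+1).
Let mesh n : R := x * n.+1%:R `^ (- beta).

Let mesh_gt0 n : 0 < mesh n. Proof. by rewrite mulr_gt0// powR_gt0. Qed.

Lemma term_mesh n l : term n l =
  mesh n ^+ p * (- mesh n ^+ 2) ^+ l * negbin (1 + beta * (idx p l)%:R) n.+1.
Proof.
rewrite /term /rbin /mesh [in RHS]exprNn -[in RHS]exprM.
have -> : n.+1%:R `^ (- (beta * (idx p l)%:R)) = (n.+1%:R `^ (- beta)) ^+ idx p l.
  by rewrite -powR_mulrn ?powR_ge0// -powRrM mulNr.
by rewrite !exprMn !exprD; ring.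
Qed.

Lemma sum_term_le : exists2 K : R, 0 < K &
  exists n0, forall K1 n L D, (n0 <= n)%N ->
  (B * B + fpsC (mesh n) * fpsC (mesh n)) * D = 1 ->
  `|mesh n ^+ p * (D * negbin (1 + beta * p%:R - 2 * beta)) n.+1| <= K1 ->
  `|\sum_(l < L) term n l| <= K1 + K * 4^-1 ^+ L.
Proof.
have [n0 [K K0 hK]] := rbin_geometric_le x0 beta01.
exists (2 * K); first by rewrite mulr_gt0.
exists n0 => K1 n L D n0n H hK1.
have tle l : `|term n l| <= K * 4^-1 ^+ l.
  rewrite /term normrM normrX normrN1 expr1n mul1r ger0_norm; last first.
    by rewrite mulr_ge0 ?exprn_ge0 ?(ltW x0) ?(ltW (rbin_gt0 _ _))// mulr_ge0// ltW.
  apply: (le_trans (hK _ _ n0n)); rewrite ler_pM2l// exprD exprM.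
  rewrite (_ : 2^-1 ^+ 2 = 4^-1); last by rewrite exprVn -natrX.
  by rewrite ler_piMl ?exprn_ge0// exprn_ile1// invf_le1// ler1n.
(* No control of [Dn] in [n] is available, but it multiplies [4^-1 ^+ J], and [J] tends to infinity
   with [n] fixed. Terms from [L] on cost a geometric tail. *)
pose Dn := \sum_(i < n.+2) `|D i|.
have Dn0 : 0 <= Dn by apply: sumr_ge0.
pose s := 1 + beta * p%:R - 2 * beta.
have sE l : s + 2 * beta * l.+1%:R = 1 + beta * (idx p l)%:R.
  by rewrite /s natrD natrM -natr1; ring.
have expand J : `|\sum_(l < J.+1) term n l| <= K1 + Dn * mesh n ^+ 2 * (K * 4^-1 ^+ J).
  pose rem := mesh n ^+ p * ((- mesh n ^+ 2) ^+ J.+1 *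
    (D * negbin (s + 2 * beta * J.+1%:R)) n.+1).
  have -> : \sum_(l < J.+1) term n l = mesh n ^+ p * (D * negbin s) n.+1 - rem.
    rewrite (resolvent_expand s J.+1 H) fpsD fps_sum fpsCM mulrDr addrK mulr_sumr.
    by apply: eq_bigr => l _; rewrite fpsCM mulrA sE -term_mesh.
  apply: (le_trans (ler_normB _ _)); apply: lerD => //.
  have -> : rem = mesh n ^+ p * (- mesh n ^+ 2) ^+ J.+1 *
      (D * negbin (1 + beta * (idx p J)%:R)) n.+1 by rewrite /rem sE mulrA.
  have hD : `|(D * negbin (1 + beta * (idx p J)%:R)) n.+1| <=
      Dn * negbin (1 + beta * (idx p J)%:R) n.+1.
    rewrite fpsM mulr_suml; apply: (le_trans (ler_norm_sum _ _ _)).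
    have b1 : 1 <= 1 + beta * (idx p J)%:R by rewrite lerDl mulr_ge0// ltW.
    apply: ler_sum => i _; rewrite normrM ler_wpM2l//.
    rewrite ger0_norm ?(ltW (negbin_gt0 _ (lt_le_trans ltr01 b1)))//.
    by apply: negbin_homo => //; exact: leq_subr.
  rewrite normrM; apply: (le_trans (ler_wpM2l (normr_ge0 _) hD)).
  rewrite mulrCA -mulrA ler_wpM2l// exprS mulrCA normrM normrN -mulrA.
  rewrite (ger0_norm (exprn_ge0 2 (ltW (mesh_gt0 n)))).
  rewrite ler_wpM2l ?exprn_ge0 ?(ltW (mesh_gt0 n))//.
  apply: le_trans (tle J); rewrite term_mesh [leRHS]normrM ler_wpM2l//.
  exact: ler_norm.
have main J : `|\sum_(l < L) term n l| <=
    K1 + 2 * K * 4^-1 ^+ L + Dn * mesh n ^+ 2 * (K * 4^-1 ^+ L) * 4^-1 ^+ J.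
  have h : \sum_(l < L) term n l = \sum_(l < L + J.+1) term n l -
      \sum_(l < J.+1) term n (L + l)%N by rewrite big_split_ord/= addrK.
  rewrite h; apply: (le_trans (ler_normB _ _)).
  have := expand (L + J)%N; rewrite -addnS => h1.
  have h2 : `|\sum_(l < J.+1) term n (L + l)%N| <= 2 * K * 4^-1 ^+ L.
    apply: (le_trans (ler_norm_sum _ _ _)).
    apply: (@le_trans _ _ (\sum_(l < J.+1) K * 4^-1 ^+ L * 4^-1 ^+ l)).
      by apply: ler_sum => l _; rewrite -mulrA -exprD.
    rewrite -mulr_sumr (_ : 2 * K * 4^-1 ^+ L = K * 4^-1 ^+ L * 2); last by ring.
    rewrite ler_wpM2l ?mulr_ge0 ?exprn_ge0 ?(ltW K0)//.
    have : \sum_(l < J.+1) 4^-1 ^+ l + 4^-1 ^+ J <= 2 :> R.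
      elim: (J) => [|j IH]; first by rewrite big_ord1 !expr0.
      rewrite big_ord_recr/= exprS; apply: le_trans IH.
      have : 0 <= 4^-1 ^+ j :> R by rewrite exprn_ge0.
      lra.
    have : 0 <= 4^-1 ^+ J :> R by rewrite exprn_ge0.
    lra.
  apply: (le_trans (lerD h1 h2)); rewrite exprD; lra.
have cv : K1 + 2 * K * 4^-1 ^+ L + Dn * mesh n ^+ 2 * (K * 4^-1 ^+ L) * 4^-1 ^+ J
    @[J --> \oo] --> K1 + 2 * K * 4^-1 ^+ L + 0.
  by apply: cvgD; [exact: cvg_cst|exact: cvg_geometric4].
rewrite addr0 in cv.
by apply: (cvgr_to_ge cv); exact: nearW.
Qed.

(** Two successive limits, [n] at fixed [L] and then [L]: the error [K * 4^-1 ^+ L] is uniform in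
    [n] and disappears in the second. *)
Lemma norm_mittag_leffler_le K1 :
  (forall n D, (B * B + fpsC (mesh n) * fpsC (mesh n)) * D = 1 ->
    `|mesh n ^+ p * (D * negbin (1 + beta * p%:R - 2 * beta)) n.+1| <= K1) ->
  `|x ^+ p * mittag_leffler (2 * beta) (1 + beta * p%:R) (- x ^+ 2)| <= K1.
Proof.
move=> hK1; have [K K0 [n0 hK]] := sum_term_le.
pose S L := \sum_(l < L) (- x ^+ 2) ^+ l * ml_coef p l.
have SL L : `|x ^+ p * S L| <= K1 + K * 4^-1 ^+ L.
  have cvS : \sum_(l < L) term n l @[n --> \oo] --> x ^+ p * S L.
    rewrite /S mulr_sumr; apply: cvg_sum_ord => l.
    have -> : x ^+ p * ((- x ^+ 2) ^+ l * ml_coef p l) =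
        (-1) ^+ l * (x ^+ idx p l * ml_coef p l).
      by rewrite [in LHS]exprNn -exprM exprD; ring.
    apply: cvgMl_tmp; apply: cvgMl_tmp; rewrite /ml_coef mlE.
    by apply: cvg_rbin; rewrite mulr_ge0// ltW.
  apply: (cvgr_to_le (cvg_norm cvS)); exists n0 => // n /= n0n.
  have [|D HD] := @fps_inv_exists _ (B * B + fpsC (mesh n) * fpsC (mesh n)).
    rewrite fpsD fpsCM fpsM big_ord1 subn0 !negbin0 mulr1 /fpsC/= gt_eqF//.
    by rewrite addr_gt0// mulr_gt0.
  exact: (hK K1 n L D n0n HD (hK1 n D HD)).
have cv1 : `|x ^+ p * S L| @[L --> \oo] -->
    `|x ^+ p * mittag_leffler (2 * beta) (1 + beta * p%:R) (- x ^+ 2)|.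
  by apply: cvg_norm; apply: cvgMl_tmp; exact: cvg_mittag_leffler.
have cv2 : K1 + K * 4^-1 ^+ L @[L --> \oo] --> K1 + 0.
  by apply: cvgD; [exact: cvg_cst|exact: cvg_geometric4].
rewrite addr0 in cv2.
by apply: (ler_cvg_to cv1 cv2); exact: nearW.
Qed.

End fixed_argument.

Lemma mittag_leffler_decay : exists2 K : R, 0 < K & forall x, 0 < x ->
  `|mittag_leffler (2 * beta) 1 (- x ^+ 2)| <= K / x /\
  `|x * mittag_leffler (2 * beta) (1 + beta) (- x ^+ 2)| <= K / x.
Proof.
have [K K0 hK] := resolvent_coef_bound beta01; exists K => // x x0.
pose mesh n : R := x * n.+1%:R `^ (- beta).
have mesh0 n : 0 < mesh n by rewrite mulr_gt0// powR_gt0.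
have meshE n : mesh n * n.+1%:R `^ beta = x.
  by rewrite /mesh powRN mulfVK// gt_eqF// powR_gt0.
have hK' n D : (B * B + fpsC (mesh n) * fpsC (mesh n)) * D = 1 ->
    `|(B * D * negbin (1 - beta)) n.+1| <= K / x /\
    `|(fpsC (mesh n) * D * negbin (1 - beta)) n.+1| <= K / x.
  by move=> H; have := hK _ n D (mesh0 n) H; rewrite meshE.
split.
- have := @norm_mittag_leffler_le x x0 0 (K / x).
  rewrite expr0 mul1r mulr0 addr0; apply => n D /hK'[h _].
  rewrite expr0 mul1r; apply: le_trans h; rewrite le_eqVlt; apply/orP; left.
  apply/eqP; congr (`|_|); rewrite -mulrA mulrCA -negbinD.
  by rewrite (_ : - beta + (1 - beta) = 1 - 2 * beta); last ring.
- have := @norm_mittag_leffler_le x x0 1 (K / x).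
  rewrite expr1 mulr1; apply => n D /hK'[_ h].
  rewrite expr1; apply: le_trans h; rewrite -(mulrA (fpsC _)) fpsCM.
  by rewrite (_ : 1 + beta - 2 * beta = 1 - beta)//; ring.
Qed.

End mittag_leffler.

(** * Small time *)

Section slope0.
Context {R : realType}.
Implicit Types (phi psi : R -> R) (s t : R).

(** A two-point form of having slope [s] at [0]. It is stable under sums and products; [w = 0]
    yields a quadratic remainder, general [z] and [w] yield monotonicity near [0] when [s] is
    nonzero. *)
Definition slope0 phi s := exists2 K : R, 0 <= K &
  forall z w, 0 <= z <= 1 -> 0 <= w <= 1 ->
    `|phi z - phi w - s * (z - w)| <= K * `|z - w| * (z + w).

Lemma slope0D phi psi s t : slope0 phi s -> slope0 psi t ->
  slope0 (fun z => phi z + psi z) (s + t).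
Proof.
move=> [K K0 hK] [L L0 hL]; exists (K + L); first exact: addr_ge0.
move=> z w z01 w01.
have -> : phi z + psi z - (phi w + psi w) - (s + t) * (z - w) =
  (phi z - phi w - s * (z - w)) + (psi z - psi w - t * (z - w)) by ring.
by rewrite !mulrDl (le_trans (ler_normD _ _))// lerD ?hK ?hL.
Qed.

Lemma slope0_lip phi s : slope0 phi s -> exists2 M : R, 0 <= M &
  forall z, 0 <= z <= 1 -> `|phi z - phi 0| <= M * z.
Proof.
move=> [K K0 hK]; exists (`|s| + K); first by rewrite addr_ge0.
move=> z z01; have /andP[z0 z1] := z01.
have := hK z 0 z01; rewrite lexx ler01 subr0 addr0 (ger0_norm z0) => /(_ isT) h.
have -> : phi z - phi 0 = (phi z - phi 0 - s * z) + s * z by ring.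
apply: (le_trans (ler_normD _ _)); rewrite normrM (ger0_norm z0) mulrDl addrC.
by rewrite lerD2l (le_trans h)// -mulrA ler_wpM2l// ler_piMr.
Qed.

Lemma slope0M phi psi s t : slope0 phi s -> slope0 psi t ->
  slope0 (fun z => phi z * psi z) (s * psi 0 + t * phi 0).
Proof.
move=> sphi spsi; have [M M0 hM] := slope0_lip sphi.
have [N N0 hN] := slope0_lip spsi.
have [K K0 hK] := sphi; have [L L0 hL] := spsi.
exists (K * (`|psi 0| + N) + `|s| * N + (`|phi 0| + M) * L + `|t| * M).
  by rewrite !addr_ge0 ?mulr_ge0 ?addr_ge0.
move=> z w z01 w01; have /andP[z0 z1] := z01; have /andP[w0 w1] := w01.
set d := z - w; set sg := z + w.
have sg0 : 0 <= sg by rewrite addr_ge0.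
have zsg : z <= sg by rewrite lerDl.
have wsg : w <= sg by rewrite lerDr.
have -> : phi z * psi z - phi w * psi w - (s * psi 0 + t * phi 0) * d =
  (phi z - phi w - s * d) * psi z + s * d * (psi z - psi 0) +
  phi w * (psi z - psi w - t * d) + t * d * (phi w - phi 0) by ring.
have hpsi : `|psi z| <= `|psi 0| + N.
  have -> : psi z = psi 0 + (psi z - psi 0) by rewrite addrC subrK.
  apply: (le_trans (ler_normD _ _)); rewrite lerD2l (le_trans (hN _ z01))//.
  by rewrite ler_piMr.
have hphi : `|phi w| <= `|phi 0| + M.
  have -> : phi w = phi 0 + (phi w - phi 0) by rewrite addrC subrK.
  apply: (le_trans (ler_normD _ _)); rewrite lerD2l (le_trans (hM _ w01))//.
  by rewrite ler_piMr.
have h1 : `|(phi z - phi w - s * d) * psi z| <= K * (`|psi 0| + N) * `|d| * sg.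
  rewrite normrM (_ : K * _ * _ * _ = K * `|d| * sg * (`|psi 0| + N)); last by ring.
  by rewrite ler_pM ?hK.
have h2 : `|s * d * (psi z - psi 0)| <= `|s| * N * `|d| * sg.
  rewrite !normrM (_ : `|s| * N * _ * _ = `|s| * `|d| * (N * sg)); last by ring.
  by rewrite ler_wpM2l ?mulr_ge0// (le_trans (hN _ z01))// ler_wpM2l.
have h3 : `|phi w * (psi z - psi w - t * d)| <= (`|phi 0| + M) * L * `|d| * sg.
  rewrite normrM (_ : _ * L * _ * _ = (`|phi 0| + M) * (L * `|d| * sg)); last by ring.
  by rewrite ler_pM ?hL.
have h4 : `|t * d * (phi w - phi 0)| <= `|t| * M * `|d| * sg.
  rewrite !normrM (_ : `|t| * M * _ * _ = `|t| * `|d| * (M * sg)); last by ring.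
  by rewrite ler_wpM2l ?mulr_ge0// (le_trans (hM _ w01))// ler_wpM2l.
move: h1 h2 h3 h4; set c1 := K * _; set c2 := `|s| * N; set c3 := _ * L.
set c4 := `|t| * M => h1 h2 h3 h4.
have -> : (c1 + c2 + c3 + c4) * `|d| * sg =
  c1 * `|d| * sg + c2 * `|d| * sg + c3 * `|d| * sg + c4 * `|d| * sg by ring.
apply: (le_trans (ler_normD _ _)); apply: lerD => //.
apply: (le_trans (ler_normD _ _)); apply: lerD => //.
by apply: (le_trans (ler_normD _ _)); exact: lerD.
Qed.

Lemma slope0_id : slope0 id 1.
Proof.
exists 0 => // z w z01 w01; rewrite mul1r subrr normr0.
by rewrite !mul0r.
Qed.

Lemma slope0_sqrt phi (c : R) : slope0 phi (- c) -> phi 0 = 1 ->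
  (forall z, 0 <= phi z) -> exists2 K : R, 0 <= K &
  forall z, 0 <= z <= 1 -> `|Num.sqrt (phi z) - 1 + c / 2 * z| <= K * z ^+ 2.
Proof.
move=> sphi phi0 phi_ge0; have [M M0 hM] := slope0_lip sphi.
have [K K0 hK] := sphi; exists ((M ^+ 2 + K) / 2).
  by rewrite divr_ge0 ?addr_ge0 ?sqr_ge0.
move=> z z01; have /andP[z0 z1] := z01.
have := hK z 0 z01; rewrite lexx ler01 subr0 addr0 (ger0_norm z0) phi0 => /(_ isT).
set f := phi z; set r := Num.sqrt f => h1.
have r0 : 0 <= r by exact: sqrtr_ge0.
have fE : f = r ^+ 2 by rewrite sqr_sqrtr// phi_ge0.
have h2 : `|r - 1| <= M * z.
  have := hM z z01; rewrite phi0 -/f fE => h; apply: le_trans h.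
  rewrite (_ : r ^+ 2 - 1 = (r - 1) * (r + 1)); last by ring.
  by rewrite normrM ler_peMr// ger0_norm ?addr_ge0// lerDr.
(* From [r ^+ 2 - 1 = 2 * (r - 1) + (r - 1) ^+ 2]; the last square is [O(z ^+ 2)] by [h2]. *)
have -> : r - 1 + c / 2 * z = (f - 1 - - c * z) / 2 - (r - 1) ^+ 2 / 2.
  by rewrite fE; field.
apply: (le_trans (ler_normB _ _)).
have n2 : `|2^-1| = 2^-1 :> R by rewrite ger0_norm.
have h3 : `|(f - 1 - - c * z) / 2| <= K * z ^+ 2 / 2.
  by rewrite normrM n2 ler_pM2r ?invr_gt0// expr2 mulrA.
have h4 : `|(r - 1) ^+ 2 / 2| <= (M * z) ^+ 2 / 2.
  rewrite normrM n2 ler_pM2r ?invr_gt0// normrX.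
  by rewrite ler_pXn2r ?nnegrE ?mulr_ge0.
apply: (le_trans (lerD h3 h4)); rewrite le_eqVlt; apply/orP; left.
by apply/eqP; field.
Qed.

End slope0.

Section small_time.
Context {R : realType}.
Variable beta : R.
Hypothesis beta01 : 0 < beta < 1.

Local Notation ml p := (mittag_leffler (2 * beta) (1 + beta * p%:R)).
Local Notation coef := (ml_coef beta).

Lemma exprB_le (z w : R) l : `|z| <= 1 -> `|w| <= 1 ->
  `|z ^+ l.+2 - w ^+ l.+2| <= l.+2%:R * (`|z - w| * (`|z| + `|w|)).
Proof.
move=> z1 w1; have P0 : 0 <= `|z - w| * (`|z| + `|w|) by rewrite mulr_ge0 ?addr_ge0.
elim: l => [|l IH].
  rewrite subr_sqr normrM (le_trans (ler_wpM2l _ (ler_normD z w)))//.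
  by rewrite ler_peMl// ler1n.
have -> : z ^+ l.+3 - w ^+ l.+3 = z * (z ^+ l.+2 - w ^+ l.+2) + (z - w) * w ^+ l.+2.
  by rewrite !(exprS _ l.+2); ring.
apply: (le_trans (ler_normD _ _)); rewrite -natr1 [leRHS]mulrDl mul1r lerD//.
  by rewrite normrM (le_trans _ IH)// ler_piMl.
rewrite normrM ler_wpM2l// normrX exprS (@le_trans _ _ `|w|) ?lerDr//.
by rewrite ler_piMr// exprn_ile1.
Qed.

Lemma mittag_leffler0 p : ml p 0 = coef p 0.
Proof.
have h := @cvg_mittag_leffler R beta beta01 p 0.
have E n : \sum_(l < n.+1) 0 ^+ l * coef p l = coef p 0.
  rewrite big_ord_recl expr0 mul1r big1 ?addr0// => i _.
  by rewrite expr0n mul0r.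
rewrite -(cvg_shiftS) (eq_cvg _ _ E) in h.
exact: (cvg_unique _ h (cvg_cst _)).
Qed.

(** Terms of degree at least two fall under [exprB_le]; the rate [4^-1] of the coefficients absorbs
    the factor [l + 2]. *)
Lemma slope0_mittag_leffler p : slope0 (fun z => ml p (- z)) (- coef p 1).
Proof.
have [K K0 hK] := ml_coef_le beta01 p (ler01 : 0 <= (1 : R)).
exists (2 * K); first by rewrite mulr_ge0// ltW.
move=> z w /andP[z0 z1] /andP[w0 w1].
pose S y n := \sum_(l < n) (- y) ^+ l * coef p l.
have cvS y : S y n.+2 @[n --> \oo] --> ml p (- y).
  have := @cvg_mittag_leffler R beta beta01 p (- y); rewrite -(cvg_shiftn 2).
  by apply: cvg_trans; apply: near_eq_cvg; apply: nearW => n /=; rewrite addn2.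
have cv : `|S z n.+2 - S w n.+2 - - coef p 1 * (z - w)| @[n --> \oo] -->
    `|ml p (- z) - ml p (- w) - - coef p 1 * (z - w)|.
  apply: cvg_norm; apply: cvgB; last exact: cvg_cst.
  by apply: cvgB; exact: cvS.
apply: (cvgr_to_le cv); apply: nearW => n.
have -> : S z n.+2 - S w n.+2 - - coef p 1 * (z - w) =
    \sum_(l < n) ((- z) ^+ l.+2 - (- w) ^+ l.+2) * coef p l.+2.
  rewrite /S !big_ord_recl/= /bump/=.
  under [in RHS]eq_bigr do rewrite mulrBl.
  rewrite sumrB; ring.
apply: (le_trans (ler_norm_sum _ _ _)).
apply: (@le_trans _ _ (\sum_(l < n) K * (`|z - w| * (z + w)) * 2^-1 ^+ l)).
  apply: ler_sum => l _; rewrite normrM (ger0_norm (ltW (ml_coef_gt0 beta01 _ _))).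
  have h1 : `|(- z) ^+ l.+2 - (- w) ^+ l.+2| <= l.+2%:R * (`|z - w| * (z + w)).
    have := @exprB_le (- z) (- w) l.
    rewrite (_ : - z - - w = - (z - w)); last by ring.
    by rewrite !normrN (ger0_norm z0) (ger0_norm w0); apply.
  have P0 : 0 <= `|z - w| * (z + w) by rewrite mulr_ge0 ?addr_ge0.
  have := hK l.+2; rewrite expr1n mul1r => h2.
  apply: (le_trans (ler_pM _ _ h1 h2)) => //; first exact: ltW (ml_coef_gt0 beta01 _ _).
  rewrite (_ : l.+2%:R * _ * _ = K * (`|z - w| * (z + w)) * (l.+2%:R * 4^-1 ^+ l.+2));
    last by ring.
  rewrite ler_wpM2l ?mulr_ge0 ?(ltW K0) ?addr_ge0//.
  apply: (@le_trans _ _ (2 ^+ l.+2 * 4^-1 ^+ l.+2)).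
    by rewrite ler_wpM2r ?exprn_ge0// -natrX ler_nat ltnW// ltn_expl.
  rewrite -exprMn (_ : 2 * 4^-1 = 2^-1); last by field.
  by rewrite ler_wiXn2l ?invr_ge0 ?invf_le1 ?ler1n// -addn2 leq_addr.
rewrite -mulr_sumr (_ : 2 * K * _ * _ = K * (`|z - w| * (z + w)) * 2); last by ring.
rewrite ler_wpM2l ?mulr_ge0 ?(ltW K0) ?addr_ge0//.
have : \sum_(l < n) 2^-1 ^+ l + 2 * 2^-1 ^+ n <= 2 :> R.
  elim: (n) => [|j IH]; first by rewrite big_ord0 expr0 add0r mulr1.
  by rewrite big_ord_recr/= exprS; lra.
have : 0 <= 2^-1 ^+ n :> R by rewrite exprn_ge0.
lra.
Qed.

Definition amplitude_sq z : R := ml 0 (- z) ^+ 2 + z * ml 1 (- z) ^+ 2.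

Definition decay_rate : R := 2 / Gamma (1 + 2 * beta) - 1 / Gamma (1 + beta) ^+ 2.

Lemma decay_rate_gt0 : 0 < decay_rate.
Proof.
have /andP[b0 b1] := beta01.
have G1 : 0 < Gamma (1 + 2 * beta) by rewrite Gamma_gt0// addr_gt0 ?mulr_gt0.
have G2 : 0 < Gamma (1 + beta) ^+ 2 by rewrite exprn_gt0// Gamma_gt0// addr_gt0.
rewrite subr_gt0 ltr_pdivrMr// mulrAC ltr_pdivlMr// mul1r.
exact: Gamma_double_lt.
Qed.

Lemma slope0_amplitude_sq : slope0 amplitude_sq (- decay_rate).
Proof.
have s0 := slope0_mittag_leffler 0; have s1 := slope0_mittag_leffler 1.
have := slope0D (slope0M s0 s0) (slope0M (@slope0_id R) (slope0M s1 s1)).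
rewrite [X in slope0 _ X](_ : _ = - decay_rate); last first.
  rewrite /= oppr0 !mittag_leffler0 mulr0 addr0 mul1r.
  have -> : coef 0 0 = 1.
    by rewrite /ml_coef !mulr0 add0r addr0 Gamma1 invr1.
  have -> : coef 0 1 = (Gamma (1 + 2 * beta))^-1.
    by rewrite /ml_coef mulr0 mulr1 addr0 addrC.
  have -> : coef 1 0 = (Gamma (1 + beta))^-1.
    by rewrite /ml_coef mulr0 mulr1 add0r.
  by rewrite /decay_rate div1r -exprVn; ring.
by move=> [K K0 hK]; exists K => // z w z01 w01; rewrite /amplitude_sq !expr2 hK.
Qed.

Lemma amplitude_sq0 : amplitude_sq 0 = 1.
Proof.
rewrite /amplitude_sq mul0r addr0 oppr0 mittag_leffler0 /ml_coef.
by rewrite !mulr0 add0r addr0 Gamma1 invr1 expr1n.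
Qed.

Lemma amplitudeE t : amplitude beta t = Num.sqrt (amplitude_sq (t `^ (2 * beta) / 4)).
Proof. by rewrite /amplitude /amplitude_sq mulr0 addr0 mulr1. Qed.

End small_time.

(** * The three claims *)

Section parts.
Context {R : realType}.
Variable beta : R.
Hypothesis beta01 : 0 < beta < 1.

Let beta0 : 0 < beta. Proof. by case/andP: beta01. Qed.

Lemma amplitude_sq_ge0 z : 0 <= z -> 0 <= amplitude_sq beta z.
Proof.
by move=> z0; apply: addr_ge0; [|apply: mulr_ge0 => //]; exact: sqr_ge0.
Qed.

Lemma time_scale_lt (e : R) : 0 < e -> exists2 delta : R, 0 < delta &
  forall t, 0 < t -> t < delta -> t `^ (2 * beta) / 4 < e.
Proof.
move=> e0; have b20 : 0 < 2 * beta by rewrite mulr_gt0.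
have e40 : 0 < 4 * e by rewrite mulr_gt0.
exists ((4 * e) `^ (2 * beta)^-1); first by rewrite powR_gt0.
move=> t t0 td; rewrite ltr_pdivrMr// [ltRHS]mulrC.
rewrite [ltRHS](_ : _ = ((4 * e) `^ (2 * beta)^-1) `^ (2 * beta)); last first.
  by rewrite -powRrM mulVf ?lt0r_neq0// powRr1 ?(ltW e40).
by apply: gt0_ltr_powR; rewrite ?nnegrE ?powR_ge0 ?(ltW t0).
Qed.

Lemma amplitude_decreasing : exists2 delta : R, 0 < delta &
  forall s t, 0 < s -> s < t -> t < delta -> amplitude beta t < amplitude beta s.
Proof.
have [K K0 hK] := slope0_amplitude_sq beta01.
have c0 := decay_rate_gt0 beta01; set c := decay_rate beta in hK c0.
(* Ensures both [2 * K * e < c], so that the slope beats the error, and [e <= 1], the range of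
   [slope0]. *)
pose e := c / (2 * K + 2 + c).
have d0 : 0 < 2 * K + 2 + c by move: c0 K0; lra.
have e0 : 0 < e by rewrite divr_gt0.
have e1 : e <= 1 by rewrite ler_pdivrMr// mul1r lerDr addr_ge0 ?mulr_ge0.
have [delta delta0 hd] := time_scale_lt e0; exists delta => // s t s0 st td.
have t0 := lt_trans s0 st; rewrite !amplitudeE.
set z := t `^ (2 * beta) / 4; set w := s `^ (2 * beta) / 4.
have ze : z < e by exact: hd.
have w0 : 0 < w by rewrite divr_gt0 ?powR_gt0.
have wz : w < z.
  rewrite ltr_pM2r ?invr_gt0//; apply: gt0_ltr_powR; rewrite ?nnegrE ?mulr_gt0//.
  - exact: ltW.
  - exact: ltW.
have z0 : 0 < z by exact: lt_trans wz.
have zw0 : 0 < z - w by rewrite subr_gt0.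
have lt_sq : amplitude_sq beta z < amplitude_sq beta w.
  have := hK z w; rewrite (ltW z0) (ltW w0) (le_trans (ltW ze) e1).
  rewrite (le_trans (ltW (lt_trans wz ze)) e1) => /(_ isT isT)/ler_normlP[_].
  rewrite (gtr0_norm zw0) => h.
  have h1 : K * (z + w) < c.
    apply: (@le_lt_trans _ _ (K * (2 * e))).
      by rewrite ler_wpM2l//; lra.
    by rewrite /e !mulrA ltr_pdivrMr//; nra.
  have : (z - w) * (K * (z + w)) < (z - w) * c by rewrite ltr_pM2l.
  lra.
rewrite ltr_sqrt//; apply: le_lt_trans lt_sq.
by apply: amplitude_sq_ge0; exact: ltW.
Qed.

Lemma amplitude_expansion :
  (fun t : R => amplitude beta t) =
  (fun t : R => 1 - t `^ (2 * beta) / 8 * decay_rate beta)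
  +O_ (0^'+) (fun t : R => t `^ (4 * beta)).
Proof.
have [K K0 hK] : exists2 K : R, 0 <= K & forall z, 0 <= z <= 1 ->
    `|Num.sqrt (amplitude_sq beta z) - 1 + decay_rate beta / 2 * z| <= K * z ^+ 2.
  (* [slope0_sqrt] asks for nonnegativity on the whole line; the absolute value supplies it and
     changes nothing on [[0, 1]]. *)
  pose phi (z : R) := amplitude_sq beta `|z|.
  have [||z|K K0 hK] := @slope0_sqrt R phi (decay_rate beta).
  - have [K K0 hK] := slope0_amplitude_sq beta01; exists K => // z w z01 w01.
    have /andP[z0 _] := z01; have /andP[w0 _] := w01.
    by rewrite /phi (ger0_norm z0) (ger0_norm w0) hK.
  - by rewrite /phi normr0 amplitude_sq0.
  - exact: amplitude_sq_ge0.
  exists K => // z z01; have /andP[z0 _] := z01.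
  by have := hK z z01; rewrite /phi (ger0_norm z0).
have [delta delta0 hd] := time_scale_lt (ltr01 : 0 < (1 : R)).
apply/eqaddOP; exists (K / 16); split; first exact: num_real.
move=> k Kk; near=> t.
have t0 : 0 < t by near: t; exact: nbhs_right_gt.
have td : t < delta by near: t; exact: nbhs_right_lt.
have z1 := hd t t0 td; set z := t `^ (2 * beta) / 4 in z1.
have z0 : 0 <= z by rewrite divr_ge0 ?powR_ge0.
have := hK z; rewrite z0 (ltW z1) => /(_ isT) h.
rewrite fctE amplitudeE -/z.
have -> : Num.sqrt (amplitude_sq beta z) - (1 - t `^ (2 * beta) / 8 * decay_rate beta)
    = Num.sqrt (amplitude_sq beta z) - 1 + decay_rate beta / 2 * z.
  by rewrite /z; field.
apply: (le_trans h).
have -> : z ^+ 2 = t `^ (4 * beta) / 16.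
  rewrite /z expr_div_n -powR_mulrn ?powR_ge0// -powRrM.
  by congr (_ `^ _ / _); [ring|rewrite -natrX].
rewrite ger0_norm ?powR_ge0// mulrA mulrAC ler_wpM2r ?powR_ge0//.
exact: ltW.
Unshelve. all: by end_near. Qed.

Lemma u_decay : exists C t0 : R, [/\ 0 < C, 0 < t0 &
  forall t x : R, t0 <= t ->
    `|u beta x t - 2 / 3| <= C * t `^ (- beta) / Gamma (1 - beta)].
Proof.
have [K K0 hK] := mittag_leffler_decay beta01.
have /andP[_ b1] := beta01.
have G0 : 0 < Gamma (1 - beta) by rewrite Gamma_gt0// subr_gt0.
(* [Gamma (1 - beta)] cancels the denominator. With [y = t^beta / 2] the two terms give
   [8/3 * K * t^(-beta)], rounded up to [3]; any positive threshold would serve. *)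
exists (3 * K * Gamma (1 - beta)), 1; split => //; first by rewrite !mulr_gt0.
move=> t x t1; have t0 := lt_le_trans ltr01 t1.
pose y := t `^ beta / 2; have y0 : 0 < y by rewrite divr_gt0 ?powR_gt0.
have yE : t `^ (2 * beta) / 4 = y ^+ 2.
  rewrite [2 * beta]mulrC powRrM powR_mulrn ?powR_ge0// /y expr_div_n.
  by rewrite -[2 ^+ 2]natrX.
have [h1 h2] := hK y y0; rewrite /u yE -/y.
set e := mittag_leffler _ 1 _ in h1 *; set f := mittag_leffler _ (1 + beta) _ in h2 *.
have -> : 2 / 3 * (1 + cos (x / 2) * e + sin (x / 2) * y * f) - 2 / 3 =
  2 / 3 * (cos (x / 2) * e + sin (x / 2) * (y * f)) by field.
have -> : 3 * K * Gamma (1 - beta) * t `^ (- beta) / Gamma (1 - beta) =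
    2 / 3 * (K / y + K / y) + K / (6 * y).
  rewrite /y powRN; have : t `^ beta != 0 by rewrite gt_eqF// powR_gt0.
  move: (t `^ beta) => q q0; field; rewrite q0 gt_eqF//.
rewrite normrM ger0_norm//.
apply: (@le_trans _ _ (2 / 3 * (K / y + K / y))); last first.
  by rewrite lerDl; apply: ltW; apply: divr_gt0 => //; exact: mulr_gt0.
rewrite ler_pM2l//; apply: (le_trans (ler_normD _ _)); apply: lerD.
  by rewrite normrM -[leRHS]mul1r ler_pM// ler_norml cos_geN1 cos_le1.
by rewrite normrM -[leRHS]mul1r ler_pM// ler_norml sin_geN1 sin_le1.
Qed.

End parts.

Theorem proposition4p1 (R : realType) (beta : R) (hbeta : 0 < beta < 1) :
  [/\ exists2 delta : R, 0 < delta &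
        forall s t : R, 0 < s -> s < t -> t < delta ->
          amplitude beta t < amplitude beta s,
      (fun t : R => amplitude beta t) =
        (fun t : R => 1 - t `^ (2 * beta) / 8 *
           (2 / Gamma (1 + 2 * beta) - 1 / Gamma (1 + beta) ^+ 2))
        +O_ (0^'+) (fun t : R => t `^ (4 * beta))
    & exists C t0 : R, [/\ 0 < C, 0 < t0 &
        forall t x : R, t0 <= t ->
          `|u beta x t - 2 / 3| <= C * t `^ (- beta) / Gamma (1 - beta)]].
Proof.
split; [exact: amplitude_decreasing|exact: amplitude_expansion|exact: u_decay].
Qed.
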